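(* Let $(A,\Delta,\kappa,\epsilon)$ be any $C^*$-quantum groupoid, with target Cartan subalgebra $A_t$, source Cartan subalgebra $A_s$ and canonical element $q\in A_t$. Let $k\in A_t$ be any positive invertible element such that $\kappa^2(k)=k$ and $E_{Z(A_t)}(k^{-1}q)=1$. For $a\in A$ define $$a^{*_k}=ka^*k^{-1},\qquad \Delta_k(a)=\Delta(a)(1\otimes k^{-1}),\qquad \kappa_k(a)=k\kappa(a)k^{-1},\qquad \epsilon_k(a)=\epsilon(ak),$$ and let $A_k$ denote the algebra $A$ equipped with the new involution $*_k$. Then $(A_k,\Delta_k,\kappa_k,\epsilon_k)$ is a $C^*$-quantum groupoid, its target and source Cartan subalgebras are the same subalgebras $A_t$ and $A_s$ as those of $(A,\Delta,\kappa,\epsilon)$, and its canonical element is $k^{-1}q$.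
   Context: A $C^*$-quantum groupoid (weak Hopf $C^*$-algebra) is a collection $(A,\Delta,\kappa,\epsilon)$ where: $A$ is a finite-dimensional (unital) $C^*$-algebra; $\Delta:A\to A\otimes A$ is a $*$-homomorphism, not necessarily unital, with $(\Delta\otimes i)\Delta=(i\otimes\Delta)\Delta$ ($i$ = identity map); $\kappa:A\to A$ (antipode) is linear with $(\kappa\circ * )^2=i$, $\kappa(xy)=\kappa(y)\kappa(x)$ for all $x,y\in A$, $(\kappa\otimes\kappa)\Delta=\varsigma\Delta\kappa$ ($\varsigma$ the flip on $A\otimes A$), and $(m(\kappa\otimes i)\otimes i)(\Delta\otimes i)\Delta(x)=(1\otimes x)\Delta(1)$ for all $x\in A$, where $m(a\otimes b)=ab$; $\epsilon$ (counit) is a positive linear form on $A$ with $(\epsilon\otimes i)\Delta=(i\otimes\epsilon)\Delta=i$ and $(\epsilon\otimes\epsilon)((x\otimes 1)\Delta(1)(1\otimes y))=\epsilon(xy)$ for all $x,y\in A$. The target and source Cartan subalgebras are the $C^*$-subalgebras $A_t=\{x\in A:\Delta(x)=\Delta(1)(x\otimes 1)=(x\otimes 1)\Delta(1)\}$ and $A_s=\{x\in A:\Delta(x)=\Delta(1)(1\otimes x)=(1\otimes x)\Delta(1)\}$. For a finite-dimensional $C^*$-algebra $N\cong\bigoplus_\gamma M_{n_\gamma}(\mathbb C)$ with minimal central projections $p^\gamma$ and a system of matrix units $\{e^\gamma_{i,j}:1\le i,j\le n_\gamma\}$, $E_{Z(N)}:N\to Z(N)$ is the canonical conditional expectation onto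 the center, $E_{Z(N)}(n)=\sum_{\gamma,i,j}\frac1{n_\gamma}e^\gamma_{i,j}\,n\,e^\gamma_{j,i}=\sum_\gamma\frac1{n_\gamma}tr_N(np^\gamma)p^\gamma$, where $tr_N$ is the sum of the usual (unnormalized) matrix traces on the blocks. The canonical element of $(A,\Delta,\kappa,\epsilon)$ is the unique invertible element $q\in A_t$ such that, for any system of matrix units $(e^\gamma_{i,j})$ of $A_t\cong\bigoplus_\gamma M_{n_\gamma}(\mathbb C)$, $\Delta(1)=\sum_\gamma\sum_{i,j}\frac1{n_\gamma}\kappa^{-1}(e^\gamma_{i,j}q)\otimes e^\gamma_{j,i}$; such an element exists, is positive, and satisfies $\kappa^2(q)=q$, $E_{Z(A_t)}(q)=1$, and $\kappa^2(x)=q^{-1}\kappa(q)xq\kappa(q^{-1})$ for all $x$ in the algebra generated by $A_t$ and $A_s$. *)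

(* Defs.v *)
From HB Require Import structures.
From mathcomp Require Import all_boot all_order all_algebra all_field.
From mathcomp Require Import complex.
From mathcomp Require Import boolp classical_sets reals.

Set Implicit Arguments.
Unset Strict Implicit.
Unset Printing Implicit Defensive.

Import Order.TTheory GRing.Theory Num.Theory.
Import VectorInternalTheory.

Local Open Scope ring_scope.

(** * Tensor products of finite-dimensional vector spaces

    [tensor V W] is realised by coordinates in the bases of [V] and [W] that
    underlie their [vectType] structures: [v ⊗ w] is the outer product of the
    coordinate vectors.  Operations on tensors are obtained by (anti)linear
    extension from pure tensors; [tlift_tens], [tmul_tens], [tmap_tens],
    [tassoc_tens], [tflip_tens] and [tstar_tens] give their values there.  [tensor] is
    deliberately not equipped with the ring structure of square matrices. *)

Section Tensor.
Variable F : fieldType.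
Implicit Types U V W : vectType F.

Definition tensor V W : Type := 'M[F]_(dim V, dim W).

HB.instance Definition _ V W := Vector.copy (tensor V W) 'M[F]_(dim V, dim W).

Definition tens V W (v : V) (w : W) : tensor V W := (v2r v)^T *m v2r w.

Definition vbas V (i : 'I_(dim V)) : V := r2v (delta_mx 0 i).

Definition tcoef V W (x : tensor V W) (i : 'I_(dim V)) (j : 'I_(dim W)) : F :=
  (x : 'M[F]_(dim V, dim W)) i j.

(* the linear map V ⊗ W -> U induced by a bilinear map B : V -> W -> U *)
Definition tlift V W (U : lmodType F) (B : V -> W -> U) (x : tensor V W) : U :=
  \sum_i \sum_j tcoef x i j *: B (vbas i) (vbas j).

End Tensor.

Notation "v ⊗ w" := (tens v w) (at level 40, left associativity) : ring_scope.

Section TensorMaps.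
Variable F : fieldType.

Definition tmap (V V' W W' : vectType F) (f : V -> V') (g : W -> W') :
    tensor V W -> tensor V' W' :=
  tlift (fun v w => f v ⊗ g w).

Definition tflip (V W : vectType F) : tensor V W -> tensor W V :=
  tlift (fun v w => w ⊗ v).

Definition tassoc (U V W : vectType F) :
    tensor (tensor U V) W -> tensor U (tensor V W) :=
  tlift (fun t w => tlift (fun u v => u ⊗ (v ⊗ w)) t).

Definition tmul (A B : falgType F) (x y : tensor A B) : tensor A B :=
  tlift (fun a b => tlift (fun c d => (a * c) ⊗ (b * d)) y) x.

Definition mulmap (A : falgType F) : tensor A A -> A :=
  tlift (fun a b => a * b).

End TensorMaps.

Arguments tassoc {F U V W}.
Arguments tflip {F V W}.
Arguments mulmap {F A}.

Notation "x ⊡ y" := (tmul x y) (at level 40, left associativity) : ring_scope.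

(* the antilinear map star ⊗ star *)
Definition tstar (R : rcfType) (A : falgType R[i]) (star : A -> A)
    (x : tensor A A) : tensor A A :=
  \sum_i \sum_j (tcoef x i j)^* *: (star (vbas i) ⊗ star (vbas j)).

Section TensorTheory.
Variable F : fieldType.

Lemma linear_comb (V U : lmodType F) n (c : 'I_n -> F) (v : 'I_n -> V)
  (f : V -> U) : linear f -> f (\sum_i c i *: v i) = \sum_i c i *: f (v i).
Proof.
move=> lf; have f0 : f 0 = 0.
  by have := lf (-1) 0 0; rewrite scaler0 addr0 scaleN1r addNr.
rewrite (big_morph f (id1 := 0) (op1 := +%R)) => [|x y|//].
  by apply: eq_bigr => i _; rewrite -[X in f X]addr0 lf f0 addr0.
by rewrite -[x in LHS]scale1r lf scale1r.
Qed.

Lemma tens_linearl (V W : vectType F) (w : W) : linear (fun v : V => v ⊗ w).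
Proof.
by move=> c u v; rewrite /tens !linearP /= mulmxDl -scalemxAl.
Qed.

Lemma tens_linearr (V W : vectType F) (v : V) : linear (fun w : W => v ⊗ w).
Proof.
by move=> c u w; rewrite /tens !linearP.
Qed.

Lemma vbas_sum (V : vectType F) (v : V) : v = \sum_i v2r v 0 i *: vbas i.
Proof.
rewrite -[LHS]v2rK [X in r2v X = _]row_sum_delta linear_sum /=.
by apply: eq_bigr => i _; rewrite linearZ.
Qed.

Lemma tcoef_tens (V W : vectType F) (v : V) (w : W) i j :
  tcoef (v ⊗ w) i j = v2r v 0 i * v2r w 0 j.
Proof. by rewrite /tcoef /tens !mxE big_ord1 !mxE. Qed.

Lemma tens_sum (V W : vectType F) (x : tensor V W) :
  x = \sum_i \sum_j tcoef x i j *: (vbas i ⊗ vbas j).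
Proof.
apply/matrixP => a b; rewrite summxE (bigD1 a) //= summxE (bigD1 b) //=.
have E i j : (tcoef x i j *: (vbas i ⊗ vbas j) : 'M_(_, _)) a b
    = tcoef x i j * ((a == i)%:R * (b == j)%:R).
  rewrite mxE -[(vbas i ⊗ vbas j) a b]/(tcoef _ _ _) tcoef_tens.
  by rewrite /vbas !r2vK !mxE !eqxx.
rewrite E !eqxx !mulr1 big1 => [|j /negPf jb]; last first.
  by rewrite E eq_sym jb !mulr0.
rewrite big1 => [|i /negPf ia]; first by rewrite !addr0.
by rewrite summxE big1 // => j _; rewrite E eq_sym ia mul0r mulr0.
Qed.

Lemma tlift_linear (V W : vectType F) (U : lmodType F) (B : V -> W -> U) :
  linear (tlift B).
Proof.
move=> c x y; rewrite /tlift scaler_sumr -big_split; apply: eq_bigr => i _ /=.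
rewrite scaler_sumr -big_split; apply: eq_bigr => j _ /=.
by rewrite /tcoef !mxE scalerDl scalerA.
Qed.

Lemma tlift_tens (V W : vectType F) (U : lmodType F) (B : V -> W -> U) v w :
  (forall a, linear (B a)) -> (forall b, linear (B^~ b)) ->
  tlift B (v ⊗ w) = B v w.
Proof.
move=> Br Bl; rewrite [in RHS](vbas_sum v) (linear_comb _ _ (Bl w)).
apply: eq_bigr => i _; rewrite [in RHS](vbas_sum w) (linear_comb _ _ (Br _)).
rewrite scaler_sumr; apply: eq_bigr => j _.
by rewrite scalerA tcoef_tens.
Qed.

Lemma tmap_tens (V V' W W' : vectType F) (f : V -> V') (g : W -> W') v w :
  linear f -> linear g -> tmap f g (v ⊗ w) = f v ⊗ g w.
Proof.
move=> lf lg; apply: tlift_tens => [a c x y|b c x y] /=.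
  by rewrite lg tens_linearr.
by rewrite lf tens_linearl.
Qed.

Lemma tflip_tens (V W : vectType F) (v : V) (w : W) : tflip (v ⊗ w) = w ⊗ v.
Proof.
by apply: tlift_tens => [a|b]; [apply: tens_linearl | apply: tens_linearr].
Qed.

Lemma tassoc_tens (U V W : vectType F) (u : U) (v : V) (w : W) :
  tassoc (u ⊗ v ⊗ w) = u ⊗ (v ⊗ w).
Proof.
rewrite /tassoc tlift_tens => [|t c x y|z].
- apply: tlift_tens => [a c x y|b c x y] /=.
    by rewrite tens_linearl tens_linearr.
  by rewrite tens_linearl.
- rewrite /tlift scaler_sumr -big_split; apply: eq_bigr => i _ /=.
  rewrite scaler_sumr -big_split; apply: eq_bigr => j _ /=.
  by rewrite !tens_linearr scalerDr !scalerA mulrC.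
- exact: tlift_linear.
Qed.

Lemma tmul_tens (A B : falgType F) (a c : A) (b d : B) :
  (a ⊗ b) ⊡ (c ⊗ d) = (a * c) ⊗ (b * d).
Proof.
have in2 (x : A) (y : B) :
    tlift (fun c d => (x * c) ⊗ (y * d)) (c ⊗ d) = (x * c) ⊗ (y * d).
  apply: tlift_tens => [u k z t|u k z t] /=.
    by rewrite mulrDr -scalerAr tens_linearr.
  by rewrite mulrDr -scalerAr tens_linearl.
rewrite /tmul; under [LHS]eq_bigr => i _ do under eq_bigr => j _ do rewrite in2.
rewrite -/(tlift (fun x y => (x * c) ⊗ (y * d)) (a ⊗ b)).
apply: tlift_tens => [u k z t|u k z t] /=.
  by rewrite mulrDl -scalerAl tens_linearr.
by rewrite mulrDl -scalerAl tens_linearl.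
Qed.

End TensorTheory.


(* A family (e^g_{i,j}) with g < nblocks e and i, j < bdim e g. *)
Record mxfamily (A : Type) := MxFamily {
  nblocks : nat;
  bdim : 'I_nblocks -> nat;
  mxu : forall g : 'I_nblocks, 'I_(bdim g) -> 'I_(bdim g) -> A }.

Arguments nblocks {A} e : rename.
Arguments bdim {A} e g : rename.
Arguments mxu {A} e g i j : rename.

Section QuantumGroupoid.
Variables (R : realType) (A : falgType R[i]).
Implicit Types (star kappa : A -> A) (Delta : A -> tensor A A) (eps : A -> R[i]).

Record is_cstar_norm star (N : A -> R) : Prop := {
  cnorm_eq0 : forall x, N x = 0 -> x = 0;
  cnormD : forall x y, N (x + y) <= N x + N y;
  cnormZ : forall c x, (N (c *: x))%:C%C = `|c| * (N x)%:C%C;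
  cnormM : forall x y, N (x * y) <= N x * N y;
  cnorm_star : forall x, N (star x * x) = N x ^+ 2 }.

(* Completeness of the norm is automatic, as A is finite-dimensional. *)
Record is_cstar_algebra star : Prop := {
  starK : involutive star;
  starD : forall x y, star (x + y) = star x + star y;
  starZ : forall c x, star (c *: x) = c^* *: star x;
  starM : forall x y, star (x * y) = star y * star x;
  star_cnorm : exists N, is_cstar_norm star N }.

Record is_quantum_groupoid star Delta kappa eps : Prop := {
  qg_cstar : is_cstar_algebra star;
  Delta_linear : linear Delta;
  DeltaM : forall x y, Delta (x * y) = Delta x ⊡ Delta y;
  Delta_star : forall x, Delta (star x) = tstar star (Delta x);
  Delta_coassoc : forall x,
    tassoc (tmap Delta id (Delta x)) = tmap id Delta (Delta x);
  kappa_linear : linear kappa;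
  kappa_star : forall x, kappa (star (kappa (star x))) = x;
  kappaM : forall x y, kappa (x * y) = kappa y * kappa x;
  kappa_Delta : forall x,
    tmap kappa kappa (Delta x) = tflip (Delta (kappa x));
  kappa_antipode : forall x,
    tmap (fun t => mulmap (tmap kappa id t)) id (tmap Delta id (Delta x))
    = (1 ⊗ x) ⊡ Delta 1;
  eps_linear : forall c x y, eps (c *: x + y) = c * eps x + eps y;
  eps_positive : forall x, 0 <= eps (star x * x);
  eps_counitl : forall x, tlift (fun a b => eps a *: b) (Delta x) = x;
  eps_counitr : forall x, tlift (fun a b => eps b *: a) (Delta x) = x;
  epsM : forall x y,
    tlift (fun a b => (eps a * eps b : R[i]^o))
      ((x ⊗ 1) ⊡ Delta 1 ⊡ (1 ⊗ y)) = eps (x * y) }.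

Definition target_cartan Delta : set A :=
  [set x | Delta x = Delta 1 ⊡ (x ⊗ 1) /\ Delta x = (x ⊗ 1) ⊡ Delta 1].

Definition source_cartan Delta : set A :=
  [set x | Delta x = Delta 1 ⊡ (1 ⊗ x) /\ Delta x = (1 ⊗ x) ⊡ Delta 1].

Definition cstar_positive star (x : A) : Prop := exists b, x = star b * b.

(* e is a system of matrix units of the unital C*-subalgebra N of (A, star).
   Linear independence of the e^g_{i,j} follows from mxu_neq0 and the
   multiplication rules. *)
Record is_mxunits star (N : set A) (e : mxfamily A) : Prop := {
  bdim_gt0 : forall g, (0 < bdim e g)%N;
  mxu_in : forall g i j, N (mxu e g i j);
  mxu_neq0 : forall g i j, mxu e g i j != 0;
  mxu_mul : forall g i j k l,
    mxu e g i j * mxu e g k l = if j == k then mxu e g i l else 0;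
  mxu_mul0 : forall g h i j k l, g != h -> mxu e g i j * mxu e h k l = 0;
  mxu_star : forall g i j, star (mxu e g i j) = mxu e g j i;
  mxu_sum1 : \sum_g \sum_i mxu e g i i = 1;
  mxu_span : forall x, N x ->
    exists c : forall g, 'I_(bdim e g) -> 'I_(bdim e g) -> R[i],
      x = \sum_g \sum_i \sum_j c g i j *: mxu e g i j }.

(* The canonical conditional expectation E_{Z(N)}.  Its value does not depend
   on the system of matrix units; one is picked by choice. *)
Definition center_expectation star (N : set A) (n : A) : A :=
  xget 0 [set z | exists2 e, is_mxunits star N e &
    z = \sum_g \sum_(i < bdim e g) \sum_(j < bdim e g)
          (bdim e g)%:R^-1 *: (mxu e g i j * n * mxu e g j i)].

Definition canonical_spec star Delta kappa (q : A) : Prop :=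
  [/\ target_cartan Delta q, q \is a GRing.unit &
    forall e, is_mxunits star (target_cartan Delta) e ->
      Delta 1 = \sum_g \sum_(i < bdim e g) \sum_(j < bdim e g)
        (bdim e g)%:R^-1 *: ((linfun kappa)^-1%VF (mxu e g i j * q) ⊗ mxu e g j i)].

Definition is_canonical_element star Delta kappa (q : A) : Prop :=
  canonical_spec star Delta kappa q /\
  forall q', canonical_spec star Delta kappa q' -> q' = q.

End QuantumGroupoid.

Lemma tstar_tens (R : realType) (A : falgType R[i]) (star : A -> A) (a b : A) :
  is_cstar_algebra star -> tstar star (a ⊗ b) = star a ⊗ star b.
Proof.
move=> cs; have s0 : star 0 = 0.
  by have := starZ cs 0 0; rewrite conjC0 !scale0r.
have ss n (f : 'I_n -> A) : star (\sum_i f i) = \sum_i star (f i).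
  exact: (big_morph star (starD cs) s0).
rewrite [in RHS](vbas_sum a) [in RHS](vbas_sum b) !ss.
under [in RHS]eq_bigr => i _ do rewrite (starZ cs).
rewrite (linear_comb _ _ (tens_linearl _)); apply: eq_bigr => i _.
under [in RHS]eq_bigr => j _ do rewrite (starZ cs).
rewrite (linear_comb _ _ (tens_linearr _)) scaler_sumr.
by apply: eq_bigr => j _; rewrite scalerA tcoef_tens rmorphM.
Qed.

(* Main.v *)
(* Proof idea.  Write k' for k^-1 and Δ(1) = Σ κ^-1(x_i q) ⊗ y_i, where
   Σ x_i ⊗ y_i is the symmetric separability idempotent of A_t; it does not
   depend on the matrix units that define it, nor on the involution.  Sliding
   elements of A_t across this tensor gives (1 ⊗ z) Δ(1) = (κ(z) ⊗ 1) Δ(1) and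
   q κ²(z) = z q for z in A_t; so k commutes with q, and E(k' q) = 1 becomes
   Δ(1) (1 ⊗ k') Δ(1) = Δ(1) together with κ(x_1) k' x_2 = κ(x_1) x_2.  The
   last two make Δ_k multiplicative and give the antipode axiom, and the first
   gives the compatibility of Δ_k with κ_k.

   The form ε is faithful on A_t, which makes the spectrum of k positive and its
   minimal polynomial separable; interpolating square roots on the spectrum
   yields c in A_t with k = c c^*.  Conjugation by c is a *-isomorphism from
   A to A_k, so it transports the C*-norm and the matrix units of A_t. *)

From HB Require Import structures.
Require Import Defs.
From mathcomp Require Import all_boot all_order all_algebra all_field.
From mathcomp Require Import complex.
From mathcomp Require Import boolp classical_sets reals.
From mathcomp Require Import ring.

Set Implicit Arguments.
Unset Strict Implicit.
Unset Printing Implicit Defensive.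

Import Order.TTheory GRing.Theory Num.Theory.
Local Open Scope ring_scope.

(** * Tensors *)

Lemma id_linear (F : fieldType) (V : lmodType F) : linear (@id V).
Proof. by []. Qed.

Lemma linear_fun0 (F : fieldType) (V U : lmodType F) (f : V -> U) :
  linear f -> f 0 = 0.
Proof.
by move=> lf; have := lf (-1) 0 0; rewrite scaler0 addr0 scaleN1r addNr.
Qed.

Lemma linear_funZ (F : fieldType) (V U : lmodType F) (f : V -> U) c v :
  linear f -> f (c *: v) = c *: f v.
Proof.
by move=> lf; rewrite -[c *: v]addr0 lf (linear_fun0 lf) addr0.
Qed.

Lemma linear_sum_fun (F : fieldType) (V U : lmodType F) (I : finType)
  (f : V -> U) (v : I -> V) : linear f -> f (\sum_i v i) = \sum_i f (v i).
Proof.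
move=> lf; apply: (big_morph f _ (linear_fun0 lf)) => x y.
by have := lf 1 x y; rewrite !scale1r.
Qed.

(** [canonical_spec] expresses the inverse of the antipode through [linfun]; this replaces it by an
    explicit inverse. On a finite-dimensional space an injective endomorphism is bijective, so a
    left inverse suffices. *)
Lemma linfun_invE (F : fieldType) (V : vectType F) (f g : V -> V) :
  linear f -> cancel f g -> (linfun f)^-1%VF =1 g.
Proof.
move=> lf fg y.
pose fM := GRing.isLinear.Build F V V *:%R f lf.
pose fL : {linear V -> V} := HB.pack f fM.
have fE : linfun f =1 f by move=> x; rewrite (lfunE fL).
have kf : lker (linfun f) == 0%VS.
  by apply/lker0P => x z; rewrite !fE => /(can_inj fg).
by rewrite -[y in RHS](lker0_lfunVK kf) fE fg.
Qed.

Section TensorAlgebra.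
Variable F : fieldType.

(** Pure tensors span. The first premise takes linear combinations, so an identity between linear or
    antilinear maps only has to be checked on pure tensors. *)
Lemma tens_ind (V W : vectType F) (P : tensor V W -> Prop) :
  (forall c x y, P x -> P y -> P (c *: x + y)) -> (forall v w, P (v ⊗ w)) ->
  forall x, P x.
Proof.
move=> PD Pp x.
have P0 : P 0.
  have := PD (-1) _ _ (Pp 0 0) (Pp 0 0).
  by rewrite scaleN1r addNr.
have Psum n (v : 'I_n -> tensor V W) : (forall i, P (v i)) -> P (\sum_i v i).
  move=> Pv; apply: (big_ind P) => // y z Py Pz.
  by rewrite -[y]scale1r; apply: PD.
rewrite (tens_sum x); do 2!apply: (Psum) => ?.
by rewrite -[X in P X]addr0; apply: PD.
Qed.

Lemma tens0l (V W : vectType F) (w : W) : (0 : V) ⊗ w = 0.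
Proof. exact: (linear_fun0 (tens_linearl w)). Qed.

Lemma tens0r (V W : vectType F) (v : V) : v ⊗ (0 : W) = 0.
Proof. exact: (linear_fun0 (tens_linearr v)). Qed.

Lemma tmap_linear (V V' W W' : vectType F) (f : V -> V') (g : W -> W') :
  linear (tmap f g).
Proof. exact: tlift_linear. Qed.

Lemma tflip_linear (V W : vectType F) : linear (@tflip F V W).
Proof. exact: tlift_linear. Qed.

Lemma tassoc_linear (U V W : vectType F) : linear (@tassoc F U V W).
Proof. exact: tlift_linear. Qed.

Lemma mulmap_linear (A : falgType F) : linear (@mulmap F A).
Proof. exact: tlift_linear. Qed.

Lemma mulmap_tens (A : falgType F) (a b : A) : mulmap (a ⊗ b) = a * b.
Proof.
by apply: tlift_tens => [u|u] c x y; rewrite ?mulrDr ?mulrDl -?scalerAr -?scalerAl.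
Qed.

Lemma mul_linearl (A : falgType F) (a : A) : linear (fun x : A => x * a).
Proof. by move=> c x y; rewrite mulrDl scalerAl. Qed.

Lemma mul_linearr (A : falgType F) (a : A) : linear (fun x : A => a * x).
Proof. by move=> c x y; rewrite mulrDr scalerAr. Qed.

Lemma comp_linear (U V W : lmodType F) (f : V -> W) (g : U -> V) :
  linear f -> linear g -> linear (fun x => f (g x)).
Proof. by move=> lf lg c x y; rewrite lg lf. Qed.

Variables A B : falgType F.
Implicit Types x y z : tensor A B.

Lemma tmul_linearl y : linear (fun x => x ⊡ y).
Proof. exact: tlift_linear. Qed.

Lemma tmul_linearr x : linear (fun y => x ⊡ y).
Proof.
move=> c y z; rewrite /tmul {1 3 5}/tlift scaler_sumr -big_split.
apply: eq_bigr => i _ /=; rewrite scaler_sumr -big_split; apply: eq_bigr => j _ /=.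
by rewrite tlift_linear scalerDr !scalerA mulrC.
Qed.

Lemma tmulA : associative (@tmul F A B).
Proof.
move=> x y z; elim/tens_ind: x => [c t u Ht Hu|a b].
  by rewrite !tmul_linearl Ht Hu.
elim/tens_ind: y => [c t u Ht Hu|a' b'].
  by rewrite tmul_linearr !tmul_linearl tmul_linearr Ht Hu.
elim/tens_ind: z => [c t u Ht Hu|a'' b''].
  by rewrite !tmul_linearr Ht Hu.
by rewrite !tmul_tens !mulrA.
Qed.

Lemma tmul1t x : (1 ⊗ 1) ⊡ x = x.
Proof.
elim/tens_ind: x => [c t u Ht Hu|a b]; first by rewrite tmul_linearr Ht Hu.
by rewrite tmul_tens !mul1r.
Qed.

Lemma tmult1 x : x ⊡ (1 ⊗ 1) = x.
Proof.
elim/tens_ind: x => [c t u Ht Hu|a b]; first by rewrite tmul_linearl Ht Hu.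
by rewrite tmul_tens !mulr1.
Qed.

End TensorAlgebra.

(** * The involution on A ⊗ A *)

Section TensorStar.
Variables (R : realType) (A : falgType R[i]) (star : A -> A).
Hypothesis cs : is_cstar_algebra star.

Lemma tstar_antilinear c (x y : tensor A A) :
  tstar star (c *: x + y) = c^* *: tstar star x + tstar star y.
Proof.
rewrite /tstar scaler_sumr -big_split; apply: eq_bigr => i _ /=.
rewrite scaler_sumr -big_split; apply: eq_bigr => j _ /=.
by rewrite /tcoef !mxE rmorphD rmorphM /= scalerDl scalerA.
Qed.

Lemma tstarM (x y : tensor A A) :
  tstar star (x ⊡ y) = tstar star y ⊡ tstar star x.
Proof.
elim/tens_ind: x => [c t u Ht Hu|a b].
  by rewrite tmul_linearl !tstar_antilinear tmul_linearr Ht Hu.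
elim/tens_ind: y => [c t u Ht Hu|a' b'].
  by rewrite tmul_linearr !tstar_antilinear tmul_linearl Ht Hu.
by rewrite tmul_tens !tstar_tens // tmul_tens !(starM cs).
Qed.

Lemma star1 : star 1 = 1.
Proof.
by rewrite -[RHS](starK cs) -[star 1 in RHS]mulr1 (starM cs) (starK cs) mulr1.
Qed.

Lemma star_unit x : x \is a GRing.unit -> star x \is a GRing.unit.
Proof.
move=> xu; apply/unitrP; exists (star x^-1).
by rewrite -!(starM cs) mulrV // mulVr // star1.
Qed.

Lemma starV x : x \is a GRing.unit -> star x^-1 = (star x)^-1.
Proof.
move=> xu; apply: (mulrI (star_unit xu)).
by rewrite -(starM cs) mulVr // mulrV ?star1 // star_unit.
Qed.

End TensorStar.

(** * Weak Hopf algebras and their Cartan subalgebras *)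

(* The axioms of a quantum groupoid that do not mention the involution; the
   inverse kinv of the antipode is part of the data. *)
Record is_weak_hopf (F : fieldType) (A : falgType F) (Delta : A -> tensor A A)
    (kappa kinv : A -> A) (eps : A -> F) : Prop := {
  wDelta_linear : linear Delta;
  wDeltaM : forall x y, Delta (x * y) = Delta x ⊡ Delta y;
  wDelta_coassoc : forall x,
    tassoc (tmap Delta id (Delta x)) = tmap id Delta (Delta x);
  wkappa_linear : linear kappa;
  wkappaK : cancel kappa kinv;
  wkinvK : cancel kinv kappa;
  wkappaM : forall x y, kappa (x * y) = kappa y * kappa x;
  wkappa_Delta : forall x,
    tmap kappa kappa (Delta x) = tflip (Delta (kappa x));
  wkappa_antipode : forall x,
    tmap (fun t => mulmap (tmap kappa id t)) id (tmap Delta id (Delta x))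
    = (1 ⊗ x) ⊡ Delta 1;
  weps_linear : linear (eps : A -> F^o);
  weps_counitl : forall x, tlift (fun a b => eps a *: b) (Delta x) = x;
  weps_counitr : forall x, tlift (fun a b => eps b *: a) (Delta x) = x;
  wepsM : forall x y,
    tlift (fun a b => (eps a * eps b : F^o))
      ((x ⊗ 1) ⊡ Delta 1 ⊡ (1 ⊗ y)) = eps (x * y) }.

(** Taken with [target_leg] or [source_leg] this unfolds to [target_cartan] or [source_cartan], so
    the closure properties of both are proved once. *)
Definition leg_cartan (F : fieldType) (A : falgType F)
    (Delta leg : A -> tensor A A) : set A :=
  [set x | Delta x = Delta 1 ⊡ leg x /\ Delta x = leg x ⊡ Delta 1].

Definition target_leg (F : fieldType) (A : falgType F) (x : A) : tensor A A :=
  x ⊗ 1.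

Definition source_leg (F : fieldType) (A : falgType F) (x : A) : tensor A A :=
  1 ⊗ x.

Section Cartan.
Variables (F : fieldType) (A : falgType F) (Delta : A -> tensor A A).
Variables (kappa kinv : A -> A) (eps : A -> F).
Hypothesis hA : is_weak_hopf Delta kappa kinv eps.

Lemma Delta1l x : Delta 1 ⊡ Delta x = Delta x.
Proof. by rewrite -(wDeltaM hA) mul1r. Qed.

Lemma Delta1r x : Delta x ⊡ Delta 1 = Delta x.
Proof. by rewrite -(wDeltaM hA) mulr1. Qed.

Lemma Delta_inj : injective Delta.
Proof. by move=> x y e; rewrite -(weps_counitl hA x) e (weps_counitl hA). Qed.

Section Leg.
Variable leg : A -> tensor A A.
Hypothesis leg_linear : linear leg.
Hypothesis leg1 : leg 1 = 1 ⊗ 1.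
Hypothesis legM : forall x y, leg (x * y) = leg x ⊡ leg y.

Local Notation cartan := (leg_cartan Delta leg).

Lemma cartan_linear c x y : cartan x -> cartan y -> cartan (c *: x + y).
Proof.
move=> [xr xl] [yr yl]; split.
  by rewrite leg_linear tmul_linearr -xr -yr (wDelta_linear hA).
by rewrite leg_linear tmul_linearl -xl -yl (wDelta_linear hA).
Qed.

Lemma cartan1 : cartan 1.
Proof. by split; rewrite leg1 ?tmul1t ?tmult1. Qed.

Lemma cartan0 : cartan 0.
Proof. by have := cartan_linear (-1) cartan1 cartan1; rewrite scaleN1r addNr. Qed.

Lemma cartanZ c x : cartan x -> cartan (c *: x).
Proof.
by move=> cx; rewrite -[_ *: _]addr0; apply: cartan_linear cx cartan0.
Qed.

Lemma cartan_comb (I : finType) (c : I -> F) (u : I -> A) :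
  (forall i, cartan (u i)) -> cartan (\sum_i c i *: u i).
Proof.
move=> cu; apply: (big_ind cartan) => [|x y cx cy|i _].
- exact: cartan0.
- by rewrite -[x]scale1r; apply: cartan_linear.
- exact: cartanZ.
Qed.

Lemma cartanM x y : cartan x -> cartan y -> cartan (x * y).
Proof.
move=> [xr xl] [yr yl]; split; rewrite legM (wDeltaM hA).
  by rewrite tmulA -xr [in LHS]yr tmulA Delta1r.
by rewrite -tmulA -yl [in LHS]xl -tmulA Delta1l.
Qed.

(** Multiplying Δ(x^-1) by the leg of x gives Δ(1); this can be solved for Δ(x^-1) because the leg
    of x is invertible. *)
Lemma cartanV x : x \is a GRing.unit -> cartan x -> cartan x^-1.
Proof.
move=> xu [xr xl].
have e1 : Delta 1 = Delta x^-1 ⊡ leg x.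
  by rewrite -{1}(mulVr xu) (wDeltaM hA) xr tmulA Delta1r.
have e2 : Delta 1 = leg x ⊡ Delta x^-1.
  by rewrite -{1}(mulrV xu) (wDeltaM hA) xl -tmulA Delta1l.
split; first by rewrite e1 -tmulA -legM mulrV // leg1 tmult1.
by rewrite e2 tmulA -legM mulVr // leg1 tmul1t.
Qed.

End Leg.

Local Notation At := (leg_cartan Delta (@target_leg F A)).
Local Notation As := (leg_cartan Delta (@source_leg F A)).

Lemma target_legM (x y : A) : target_leg (x * y) = target_leg x ⊡ target_leg y.
Proof. by rewrite /target_leg tmul_tens mulr1. Qed.

Lemma target_linear c x y : At x -> At y -> At (c *: x + y).
Proof. by apply: cartan_linear; apply: tens_linearl. Qed.

Lemma target1 : At 1. Proof. exact: cartan1. Qed.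

Lemma targetZ c x : At x -> At (c *: x).
Proof. by apply: cartanZ => //; apply: tens_linearl. Qed.

Lemma targetM x y : At x -> At y -> At (x * y).
Proof. exact: (cartanM target_legM). Qed.

Lemma targetV x : x \is a GRing.unit -> At x -> At x^-1.
Proof. by apply: (cartanV _ target_legM). Qed.

Lemma source_comb (I : finType) (c : I -> F) (u : I -> A) :
  (forall i, As (u i)) -> As (\sum_i c i *: u i).
Proof. by apply: cartan_comb => //; apply: tens_linearr. Qed.

Lemma legs_comm (x y : A) : target_leg x ⊡ source_leg y = source_leg y ⊡ target_leg x.
Proof. by rewrite !tmul_tens !mul1r !mulr1. Qed.

(** The legs of x and y act on different tensor factors, so Δ(x y) = Δ(y x); the counit makes Δ
    injective. *)
Lemma target_source_comm x y : At x -> As y -> x * y = y * x.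
Proof.
move=> [_ xl] [_ yl]; apply: Delta_inj; rewrite !(wDeltaM hA).
rewrite [in LHS]xl -tmulA Delta1l [in LHS]yl tmulA legs_comm -tmulA -xl.
by rewrite -[in LHS]Delta1l tmulA -yl.
Qed.

Lemma wkinv_linear : linear kinv.
Proof.
move=> c x y; apply: (can_inj (wkappaK hA)).
by rewrite (wkappa_linear hA) !(wkinvK hA).
Qed.

Lemma wkinvM x y : kinv (x * y) = kinv y * kinv x.
Proof. by apply: (can_inj (wkappaK hA)); rewrite (wkappaM hA) !(wkinvK hA). Qed.

Lemma kappa1 : kappa 1 = 1.
Proof.
by rewrite -[LHS]mulr1 -{2}(wkinvK hA 1) -(wkappaM hA) mulr1 (wkinvK hA).
Qed.

Lemma tmap_kappaM (x y : tensor A A) :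
  tmap kappa kappa (x ⊡ y) = tmap kappa kappa y ⊡ tmap kappa kappa x.
Proof.
have lk := wkappa_linear hA.
elim/tens_ind: x => [c t u Ht Hu|a b].
  by rewrite tmul_linearl !tmap_linear tmul_linearr Ht Hu.
elim/tens_ind: y => [c t u Ht Hu|a' b'].
  by rewrite tmul_linearr !tmap_linear tmul_linearl Ht Hu.
by rewrite tmul_tens !tmap_tens // tmul_tens !(wkappaM hA).
Qed.

Lemma tflipM (x y : tensor A A) : tflip (x ⊡ y) = tflip x ⊡ tflip y.
Proof.
elim/tens_ind: x => [c t u Ht Hu|a b].
  by rewrite tmul_linearl !tflip_linear tmul_linearl Ht Hu.
elim/tens_ind: y => [c t u Ht Hu|a' b'].
  by rewrite tmul_linearr !tflip_linear tmul_linearr Ht Hu.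
by rewrite tmul_tens !tflip_tens tmul_tens.
Qed.

Lemma tflipK (x : tensor A A) : tflip (tflip x) = x.
Proof.
elim/tens_ind: x => [c t u Ht Hu|a b]; first by rewrite !tflip_linear Ht Hu.
by rewrite !tflip_tens.
Qed.

Lemma Delta_kappa x : Delta (kappa x) = tflip (tmap kappa kappa (Delta x)).
Proof. by rewrite (wkappa_Delta hA) tflipK. Qed.

End Cartan.

(** * Separability idempotents *)

Definition bilin (F : fieldType) (V W U : lmodType F) (B : V -> W -> U) : Prop :=
  (forall a, linear (B a)) /\ (forall b, linear (B^~ b)).

Lemma scale_bilin_l (F : fieldType) (V W : lmodType F) (f : V -> F^o) :
  linear f -> bilin (fun (v : V) (w : W) => (f v : F) *: w).
Proof.
move=> lf; split=> [v|w] d u u' /=; first by rewrite scalerDr !scalerA mulrC.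
by rewrite lf scalerDl scalerA.
Qed.

Lemma scale_bilin_r (F : fieldType) (V W : lmodType F) (f : V -> F^o) :
  linear f -> bilin (fun (w : W) (v : V) => (f v : F) *: w).
Proof. by move/(@scale_bilin_l _ _ W) => []. Qed.

Lemma tlift_sum (F : fieldType) (V W : vectType F) (U : lmodType F)
  (B : V -> W -> U) (I : finType) (u : I -> V) (v : I -> W) :
  bilin B -> tlift B (\sum_i u i ⊗ v i) = \sum_i B (u i) (v i).
Proof.
move=> [Br Bl]; rewrite (linear_sum_fun _ (@tlift_linear _ _ _ _ B)).
by apply: eq_bigr => i _; rewrite tlift_tens.
Qed.

(* For a separable algebra, Σ x_i ⊗ y_i is its symmetric separability
   idempotent. *)
Record is_sep_family (F : fieldType) (A : falgType F) (N : set A) (I : finType)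
    (x y : I -> A) : Prop := {
  sep_in_l : forall i, N (x i);
  sep_in_r : forall i, N (y i);
  sep_outer : forall a, N a ->
    \sum_i (a * x i) ⊗ y i = \sum_i x i ⊗ (y i * a);
  sep_inner : forall a, N a ->
    \sum_i (x i * a) ⊗ y i = \sum_i x i ⊗ (a * y i);
  sep_xy : \sum_i x i * y i = 1;
  sep_yx : \sum_i y i * x i = 1 }.

Section SepFamily.
Variables (F : fieldType) (A : falgType F) (N : set A).

Lemma sep_bilin_outer (I : finType) (x y : I -> A) (U : lmodType F)
  (B : A -> A -> U) a :
  is_sep_family N x y -> N a -> bilin B ->
  \sum_i B (a * x i) (y i) = \sum_i B (x i) (y i * a).
Proof.
move=> s Na bB; rewrite -(tlift_sum (fun i => a * x i) y bB) (sep_outer s Na).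
exact: tlift_sum.
Qed.

Lemma sep_bilin_inner (I : finType) (x y : I -> A) (U : lmodType F)
  (B : A -> A -> U) a :
  is_sep_family N x y -> N a -> bilin B ->
  \sum_i B (x i * a) (y i) = \sum_i B (x i) (a * y i).
Proof.
move=> s Na bB; rewrite -(tlift_sum (fun i => x i * a) y bB) (sep_inner s Na).
exact: tlift_sum.
Qed.

Lemma sep_flip (I : finType) (x y : I -> A) :
  is_sep_family N x y -> is_sep_family N y x.
Proof.
have fl (u v : I -> A) : \sum_i v i ⊗ u i = tflip (\sum_i u i ⊗ v i).
  rewrite (linear_sum_fun _ (@tflip_linear _ _ _)).
  by apply: eq_bigr => i _; rewrite tflip_tens.
move=> s; case: (s) => xN yN outer inner xy yx; split => // a Na.
  by rewrite fl (fl (fun i => x i * a)) inner.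
by rewrite fl (fl (fun i => a * x i)) outer.
Qed.

(** Both tensors equal Σ x_i x'_j ⊗ y'_j y_i. Sliding x'_j across the first family leaves the factor
    Σ y'_j x'_j = 1, and sliding x_i across the second leaves Σ x_i y_i = 1. *)
Lemma sep_unique (I J : finType) (x y : I -> A) (x' y' : J -> A) :
  is_sep_family N x y -> is_sep_family N x' y' ->
  \sum_i x i ⊗ y i = \sum_j x' j ⊗ y' j.
Proof.
move=> s s'; transitivity (\sum_i \sum_j (x i * x' j) ⊗ (y' j * y i)).
  rewrite exchange_big /=.
  under [RHS]eq_bigr => j _.
    rewrite (@sep_bilin_inner _ _ _ _ (fun a b => a ⊗ (y' j * b)) _ s).
    over.
    exact: sep_in_l s' j.
    split=> [a|b]; last exact: tens_linearl.
    by apply: comp_linear; [apply: tens_linearr | apply: mul_linearr].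
  rewrite exchange_big; apply: eq_bigr => i _ /=.
  rewrite -(linear_sum_fun _ (tens_linearr _)); congr (_ ⊗ _).
  under eq_bigr => j _ do rewrite mulrA.
  by rewrite -mulr_suml (sep_yx s') mul1r.
under eq_bigr => i _.
  rewrite (@sep_bilin_outer _ _ _ _ (fun a b => a ⊗ (b * y i)) _ s').
  over.
  exact: sep_in_l s i.
  split=> [a|b]; last exact: tens_linearl.
  by apply: comp_linear; [apply: tens_linearr | apply: mul_linearl].
rewrite exchange_big; apply: eq_bigr => j _ /=.
rewrite -(linear_sum_fun _ (tens_linearr _)); congr (_ ⊗ _).
under eq_bigr => i _ do rewrite -mulrA.
by rewrite -mulr_sumr (sep_xy s) mulr1.
Qed.

Lemma sep_transfer (I J : finType) (x y : I -> A) (x' y' : J -> A)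
  (U : lmodType F) (B : A -> A -> U) :
  is_sep_family N x y -> is_sep_family N x' y' -> bilin B ->
  \sum_i B (x i) (y i) = \sum_j B (x' j) (y' j).
Proof.
move=> s s' bB.
by rewrite -(tlift_sum x y bB) (sep_unique s s') (tlift_sum x' y' bB).
Qed.

(** The flipped family is again a separability family, so uniqueness makes the idempotent
    symmetric. *)
Lemma sep_expect_sym (I : finType) (x y : I -> A) n :
  is_sep_family N x y -> \sum_i y i * n * x i = \sum_i x i * n * y i.
Proof.
move=> s; have bB : bilin (fun a b : A => a * n * b).
  split=> [a|b]; first exact: mul_linearr.
  by apply: (@comp_linear _ _ _ _ (fun u => u * b)); apply: mul_linearl.
exact: sep_transfer (sep_flip s) s bB.
Qed.

End SepFamily.

(** * Consequences of writing Δ(1) through the separability idempotent of A_t *)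

Section SeparableDelta.
Variables (F : fieldType) (A : falgType F) (Delta : A -> tensor A A).
Variables (kappa kinv : A -> A) (eps : A -> F).
Hypothesis hA : is_weak_hopf Delta kappa kinv eps.
Local Notation At := (leg_cartan Delta (@target_leg F A)).
Local Notation As := (leg_cartan Delta (@source_leg F A)).

Variables (I : finType) (x y : I -> A) (q : A).
Hypothesis sxy : is_sep_family At x y.
Hypothesis q_target : At q.
Hypothesis Delta1E : Delta 1 = \sum_i kinv (x i * q) ⊗ y i.

Lemma tmul_suml (J : finType) (f : J -> tensor A A) t :
  (\sum_j f j) ⊡ t = \sum_j f j ⊡ t.
Proof. exact: linear_sum_fun (tmul_linearl t). Qed.

Lemma tmul_sumr (J : finType) (f : J -> tensor A A) t :
  t ⊡ (\sum_j f j) = \sum_j t ⊡ f j.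
Proof. exact: linear_sum_fun (tmul_linearr t). Qed.

Lemma kinv_bilin (f g : A -> A) : linear f -> linear g ->
  bilin (fun a b => kinv (f a) ⊗ g b).
Proof.
move=> lf lg; split=> [a|b].
  by apply: comp_linear lg; apply: tens_linearr.
apply: (@comp_linear _ _ _ _ (fun u => u ⊗ g b)); first exact: tens_linearl.
by apply: comp_linear lf; apply: wkinv_linear hA.
Qed.

Lemma Delta1_target_r z :
  At z -> Delta 1 ⊡ source_leg z = Delta 1 ⊡ target_leg (kinv z).
Proof.
move=> Nz; rewrite Delta1E !tmul_suml.
under eq_bigr => i _ do rewrite tmul_tens mulr1.
rewrite -(@sep_bilin_outer _ _ _ _ _ _ _ (fun a b => kinv (a * q) ⊗ b) _ sxy) //.
  by apply: eq_bigr => i _; rewrite tmul_tens mulr1 -mulrA (wkinvM hA).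
by apply: kinv_bilin => //; apply: mul_linearl.
Qed.

(** The flip composed with κ ⊗ κ is antimultiplicative and fixes Δ(1), so it carries
    [Delta1_target_r] to this identity. *)
Lemma Delta1_target_l z :
  At z -> source_leg z ⊡ Delta 1 = target_leg (kappa z) ⊡ Delta 1.
Proof.
move=> Nz; have lk := wkappa_linear hA.
have d1 : Delta 1 = tflip (tmap kappa kappa (Delta 1)).
  by rewrite -(Delta_kappa hA) (kappa1 hA).
have e := congr1 (fun t => tflip (tmap kappa kappa t)) (Delta1_target_r Nz).
rewrite /= !(tmap_kappaM hA) !tflipM -d1 !tmap_tens // !tflip_tens in e.
by rewrite (kappa1 hA) (wkinvK hA) in e; rewrite /source_leg -e.
Qed.

(** Apply a ⊗ b ↦ b κ(a) to [Delta1_target_l]: each side collapses by Σ y_i x_i = 1, one to z q and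
    the other to q κ²(z). *)
Lemma target_kappa2 z : At z -> q * kappa (kappa z) = z * q.
Proof.
move=> Nz.
have lk := wkappa_linear hA.
pose B a b := b * kappa a.
have bB : bilin B.
  split=> [a|b]; first exact: mul_linearl.
  by apply: comp_linear lk; apply: mul_linearr.
have := congr1 (tlift B) (Delta1_target_l Nz).
rewrite Delta1E !tmul_sumr.
under eq_bigr => i _ do rewrite tmul_tens mul1r.
rewrite -(@sep_bilin_inner _ _ _ _ _ _ _ (fun a b => kinv (a * q) ⊗ b) _ sxy) //; last first.
  by apply: kinv_bilin => //; apply: mul_linearl.
under [X in _ = tlift _ X]eq_bigr => i _ do rewrite tmul_tens mul1r.
rewrite !(tlift_sum _ _ bB) /B.
under eq_bigr => i _ do rewrite (wkinvK hA) !mulrA.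
under [X in _ = X]eq_bigr => i _ do rewrite (wkappaM hA) (wkinvK hA) !mulrA.
by rewrite -!mulr_suml (sep_yx sxy) !mul1r.
Qed.

(** κ ⊗ κ sends Δ(κ^-1(z)) to the flip of Δ(z) and reverses products. It therefore turns the two
    conditions of A_s on κ^-1(z) into those of A_t on z, with left and right exchanged. *)
Lemma kinv_target z : At z -> As (kinv z).
Proof.
move=> Nz; have lk := wkappa_linear hA; have li := wkinv_linear hA.
have kk_inj (t u : tensor A A) :
    tmap kappa kappa t = tmap kappa kappa u -> t = u.
  apply: (can_inj (g := tmap kinv kinv)).
  elim/tens_ind=> [c v w Hv Hw|a b]; first by rewrite !tmap_linear Hv Hw.
  by rewrite !tmap_tens // !(wkappaK hA).
have fl : tflip (target_leg z) = source_leg z by rewrite /target_leg tflip_tens.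
have ks : tmap kappa kappa (source_leg (kinv z)) = source_leg z.
  by rewrite tmap_tens // (kappa1 hA) (wkinvK hA).
case: Nz => zr zl; split; apply: kk_inj.
  by rewrite (tmap_kappaM hA) !(wkappa_Delta hA) (wkinvK hA) (kappa1 hA) ks zl
    tflipM fl.
by rewrite (tmap_kappaM hA) !(wkappa_Delta hA) (wkinvK hA) (kappa1 hA) ks zr
  tflipM fl.
Qed.

(** One of the two source equations suffices: applying the counit to the second leg writes z as a
    combination of the κ^-1(x_i q), which lie in A_s. *)
Lemma source_of_left z : Delta z = source_leg z ⊡ Delta 1 -> As z.
Proof.
move=> zl; have {zl}-> : z = \sum_i eps (z * y i) *: kinv (x i * q).
  rewrite -[LHS](weps_counitr hA) zl Delta1E tmul_sumr.
  under eq_bigr => i _ do rewrite tmul_tens mul1r.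
  by rewrite tlift_sum //; apply: scale_bilin_r (weps_linear hA).
apply: (source_comb hA) => i; apply: kinv_target.
by apply: (targetM hA) => //; apply: sep_in_l sxy i.
Qed.

(** The map a ⊗ b ↦ b κ(a) recovers the parameter, since Σ y_i x_i = 1. This is what makes the
    canonical element unique. *)
Lemma kinv_family_inj p : Delta 1 = \sum_i kinv (x i * p) ⊗ y i -> p = q.
Proof.
pose B a b := b * kappa a.
have bB : bilin B.
  split=> [a|b]; first exact: mul_linearl.
  exact: comp_linear (mul_linearr b) (wkappa_linear hA).
have e r : tlift B (\sum_i kinv (x i * r) ⊗ y i) = r.
  rewrite tlift_sum // /B.
  under eq_bigr => i _ do rewrite (wkinvK hA) mulrA.
  by rewrite -mulr_suml (sep_yx sxy) mul1r.
by move=> p1; rewrite -[p]e -p1 Delta1E e.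
Qed.

End SeparableDelta.

(** * Twisting a weak Hopf algebra *)

Definition twist_Delta (F : fieldType) (A : falgType F)
    (Delta : A -> tensor A A) (k a : A) := Delta a ⊡ (1 ⊗ k^-1).

(** Serves both for the twisted antipode and for the twisted involution. *)
Definition twist_map (R : unitRingType) (f : R -> R) (k a : R) :=
  k * f a * k^-1.

Section Twist.
Variables (F : fieldType) (A : falgType F) (Delta : A -> tensor A A).
Variables (kappa kinv : A -> A) (eps : A -> F).
Hypothesis hA : is_weak_hopf Delta kappa kinv eps.
Local Notation At := (leg_cartan Delta (@target_leg F A)).
Local Notation As := (leg_cartan Delta (@source_leg F A)).

Variables (I : finType) (x y : I -> A) (q k : A).
Hypothesis sxy : is_sep_family At x y.
Hypothesis q_target : At q.
Hypothesis Delta1E : Delta 1 = \sum_i kinv (x i * q) ⊗ y i.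
Hypothesis k_target : At k.
Hypothesis k_unit : k \is a GRing.unit.
Hypothesis k_kappa2 : kappa (kappa k) = k.
Hypothesis k_expect : \sum_i x i * (k^-1 * q) * y i = 1.

Let kV_target : At k^-1. Proof. exact: targetV hA _ k_unit k_target. Qed.

(** With κ²(k) = k, the identity q κ²(k) = k q says that k commutes with q. *)
Lemma twist_comm : k^-1 * q = q * k^-1.
Proof.
have qk := target_kappa2 hA sxy Delta1E k_target.
by rewrite k_kappa2 in qk; apply/esym/commrV.
Qed.

(** The product expands to Σ κ^-1(x_j q x_i q) ⊗ y_i k^-1 y_j. Sliding q x_i q to the right produces
    Σ y_i k^-1 q x_i, which is 1 by [k_expect] and symmetry; the remaining q slides back to restore
    Δ(1). *)
Lemma Delta1_twist : Delta 1 ⊡ source_leg k^-1 ⊡ Delta 1 = Delta 1.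
Proof.
have lid := @id_linear F A.
have -> : Delta 1 ⊡ source_leg k^-1 = \sum_i kinv (x i * q) ⊗ (y i * k^-1).
  rewrite Delta1E tmul_suml; apply: eq_bigr => i _.
  by rewrite tmul_tens mulr1.
transitivity (\sum_i \sum_j
    kinv (x j) ⊗ (y i * k^-1 * (q * x i * q * y j))).
  rewrite tmul_suml; apply: eq_bigr => i _; rewrite Delta1E tmul_sumr.
  have qN : At (q * x i * q).
    by do 2!apply: (targetM hA) => //; apply: sep_in_l sxy i.
  have bB : bilin (fun a b => kinv a ⊗ (y i * k^-1 * b)).
    exact: (kinv_bilin hA lid (mul_linearr _)).
  rewrite -(sep_bilin_inner sxy qN bB); apply: eq_bigr => j _.
  by rewrite tmul_tens -(wkinvM hA) !mulrA.
have bB : bilin (fun a b : A => kinv a ⊗ b) by apply: (kinv_bilin hA lid lid).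
rewrite exchange_big Delta1E (sep_bilin_inner sxy q_target bB).
apply: eq_bigr => j _ /=; rewrite -(linear_sum_fun _ (tens_linearr _)).
under eq_bigr => i _ do
  rewrite -!mulrA (mulrA k^-1) (mulrA (y i)) (mulrA _ (x i)).
by rewrite -mulr_suml (sep_expect_sym _ sxy) k_expect mul1r.
Qed.

Lemma antipode_twist_bilin : bilin (fun a b => kappa a * k^-1 * b).
Proof.
split=> [a|b]; first exact: mul_linearr.
apply: comp_linear (mul_linearl _) _.
exact: comp_linear (mul_linearl _) (wkappa_linear hA).
Qed.

(** On a pure tensor a ⊗ b, κ turns the first leg of Δ(1) back into x_i q, so that Σ x_i q k^-1 y_i
    appears between κ(a) and b. It is 1 because q and k commute. *)
Lemma antipode_twist (t : tensor A A) :
  tlift (fun a b => kappa a * k^-1 * b) (Delta 1 ⊡ t) =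
  mulmap (tmap kappa id t).
Proof.
have lk := wkappa_linear hA.
have bB := antipode_twist_bilin.
elim/tens_ind: t => [c t u Ht Hu|a b].
  by rewrite tmul_linearr tlift_linear Ht Hu tmap_linear mulmap_linear.
rewrite tmap_tens // mulmap_tens Delta1E tmul_suml.
under eq_bigr => i _ do rewrite tmul_tens.
rewrite tlift_sum //.
under eq_bigr => i _ do
  rewrite (wkappaM hA) (wkinvK hA) -!mulrA (mulrA q) -twist_comm !mulrA.
rewrite -mulr_suml; congr (_ * _).
under eq_bigr => i _ do rewrite -!mulrA.
rewrite -mulr_sumr -[RHS]mulr1 -k_expect; congr (_ * _).
by apply: eq_bigr => i _; rewrite !mulrA.
Qed.

(** * Verification of the weak Hopf axioms for the twisted maps *)

Local Notation Dk := (twist_Delta Delta k).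
Local Notation kk := (twist_map kappa k).
Local Notation kkinv := (fun a => kinv (k^-1 * a * k)).
Local Notation ek := (fun a => eps (a * k)).

Lemma Dk_linear : linear Dk.
Proof. exact: comp_linear (tmul_linearl _) (wDelta_linear hA). Qed.

Lemma kk_linear : linear kk.
Proof.
apply: comp_linear (mul_linearl _) _.
exact: comp_linear (mul_linearr _) (wkappa_linear hA).
Qed.

Lemma twist_iterated t :
  tmap Dk id (t ⊡ (1 ⊗ k^-1)) =
  tmap (fun u => u ⊡ (1 ⊗ k^-1)) (fun b => b * k^-1) (tmap Delta id t).
Proof.
have lD := Dk_linear; have lD' := wDelta_linear hA.
elim/tens_ind: t => [c t u Ht Hu|a b].
  by rewrite tmul_linearl !tmap_linear Ht Hu.
rewrite tmul_tens mulr1 !tmap_tens //; first exact: tmul_linearl.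
exact: mul_linearl.
Qed.

Lemma twist_coassoc a :
  tassoc (tmap Dk id (Dk a)) = tmap id Dk (Dk a).
Proof.
have lD := Dk_linear; have lD' := wDelta_linear hA.
rewrite [Dk a in LHS]/twist_Delta twist_iterated.
pose rho := fun t : tensor A A => t ⊡ (1 ⊗ k^-1); rewrite -/rho.
have lr : linear rho by apply: tmul_linearl.
have lb := mul_linearl k^-1.
pose rr := fun t : tensor A A => t ⊡ (k^-1 ⊗ k^-1).
have lrr : linear rr by apply: tmul_linearl.
have e1 t : tassoc (tmap rho (fun b => b * k^-1) t) = tmap id rr (tassoc t).
  elim/tens_ind: t => [c t u Ht Hu|t w].
    by rewrite !(tmap_linear, tassoc_linear) Ht Hu.
  elim/tens_ind: t => [c t u Ht Hu|u v].
    by rewrite tens_linearl !(tmap_linear, tassoc_linear) Ht Hu.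
  by rewrite tmap_tens // {1}/rho tmul_tens !tassoc_tens tmap_tens // /rr
    tmul_tens mulr1.
rewrite e1 (wDelta_coassoc hA) {2}/twist_Delta.
elim/tens_ind: (Delta a) => [c t u Ht Hu|u v].
  by rewrite tmul_linearl !tmap_linear Ht Hu.
rewrite tmul_tens mulr1 !tmap_tens //; congr (_ ⊗ _).
(* As k^-1 lies in A_t, Δ(v k^-1) (1 ⊗ k^-1) = Δ(v) (k^-1 ⊗ k^-1). *)
rewrite /twist_Delta (wDeltaM hA) [Delta k^-1](proj1 kV_target) /rr.
by rewrite tmulA (Delta1r hA) -tmulA tmul_tens mulr1 mul1r.
Qed.

(** Absorbing Δ(1) into Δ(a) on the right and into Δ(b) on the left surrounds 1 ⊗ k^-1 with two
    copies of Δ(1), where [Delta1_twist] removes it. *)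
Lemma twist_DeltaM a b : Dk (a * b) = Dk a ⊡ Dk b.
Proof.
rewrite /twist_Delta (wDeltaM hA) tmulA; congr (_ ⊡ _).
rewrite -{1}(Delta1r hA a) -{2}(Delta1r hA a) -{2}(Delta1l hA b).
by rewrite -{1}Delta1_twist !tmulA.
Qed.

Lemma twist_antipode a :
  tmap (fun t => mulmap (tmap kk id t)) id (tmap Dk id (Dk a))
    = (1 ⊗ a) ⊡ Dk 1.
Proof.
have lD := wDelta_linear hA; have lk := wkappa_linear hA; have lkk := kk_linear.
have lb := mul_linearl k^-1.
pose S t := mulmap (tmap kappa id t).
pose S' t := mulmap (tmap kk id t).
pose conj u := k * u * k^-1.
have lS : linear S.
  by apply: (comp_linear (@mulmap_linear _ _) (@tmap_linear _ _ _ _ _ _ _)).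
have lS' : linear S'.
  by apply: (comp_linear (@mulmap_linear _ _) (@tmap_linear _ _ _ _ _ _ _)).
have lr : linear (fun t : tensor A A => t ⊡ (1 ⊗ k^-1)) by apply: tmul_linearl.
have lconj : linear conj by apply: (comp_linear lb (mul_linearr k)).
(* On b ⊗ c the left side is k κ(b) k^-1 c k^-1; the inner k^-1 disappears by [antipode_twist],
   since Δ(u) = Δ(1) Δ(u). *)
have eS u : S' (Delta u ⊡ (1 ⊗ k^-1)) = conj (S (Delta u)).
  rewrite /S -antipode_twist (Delta1l hA) /S' /conj.
  elim/tens_ind: (Delta u) => [c t v Ht Hv|b c].
    rewrite tmul_linearl tmap_linear mulmap_linear tlift_linear Ht Hv.
    exact/esym/lconj.
  rewrite tmul_tens tmap_tens // mulmap_tens; have [br bl] := antipode_twist_bilin.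
  by rewrite tlift_tens // /twist_map mulr1 !mulrA.
rewrite [Dk a]/twist_Delta twist_iterated -/S'.
transitivity (tmap conj (fun b => b * k^-1) (tmap S id (tmap Delta id (Delta a)))).
  elim/tens_ind: (Delta a) => [c t u Ht Hu|b c]; first by rewrite !tmap_linear Ht Hu.
  by rewrite !tmap_tens // eS.
rewrite (wkappa_antipode hA).
have -> t : tmap conj (fun b => b * k^-1) t = (k ⊗ 1) ⊡ t ⊡ (k^-1 ⊗ k^-1).
  elim/tens_ind: t => [c t u Ht Hu|b c].
    by rewrite tmap_linear tmul_linearr tmul_linearl Ht Hu.
  by rewrite tmap_tens // !tmul_tens mul1r.
(* k ⊗ 1 commutes with 1 ⊗ a and, as k lies in A_t, with Δ(1); it then cancels the first leg of k^-1
   ⊗ k^-1. *)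
have [kr kl] := k_target; rewrite /target_leg in kr kl.
rewrite tmulA.
have -> : (k ⊗ 1) ⊡ (1 ⊗ a) = (1 ⊗ a) ⊡ (k ⊗ 1).
  by rewrite !tmul_tens !mul1r !mulr1.
rewrite -(tmulA (1 ⊗ a)) -kl kr -!tmulA tmul_tens mulrV // mul1r.
by [].
Qed.

(** After a flip, the left side is (k κ(k^-1) ⊗ k) Δ(κ(a)) (k^-1 ⊗ k^-1). Here (1 ⊗ k) Δ(1) = (κ(k)
    ⊗ 1) Δ(1) cancels κ(k^-1), and the rest is Δ(k κ(a) k^-1) (1 ⊗ k^-1) because k and k^-1 lie in
    A_t. *)
Lemma twist_kappa_Delta a : tmap kk kk (Dk a) = tflip (Dk (kk a)).
Proof.
have lk := wkappa_linear hA; have lkk := kk_linear.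
have [kr kl] := k_target; have [kVr kVl] := kV_target.
rewrite /target_leg in kr kl kVr kVl.
have e t : tmap kk kk (t ⊡ (1 ⊗ k^-1))
    = (k ⊗ (k * kappa k^-1)) ⊡ tmap kappa kappa t ⊡ (k^-1 ⊗ k^-1).
  elim/tens_ind: t => [c t u Ht Hu|b c].
    by rewrite tmul_linearl !tmap_linear tmul_linearr tmul_linearl Ht Hu.
  by rewrite tmul_tens !tmap_tens // !tmul_tens /twist_map mulr1 (wkappaM hA)
    !mulrA.
rewrite {1}/twist_Delta e (wkappa_Delta hA).
rewrite -[LHS]tflipK; congr tflip.
have f b c : b ⊗ c = tflip (c ⊗ b) :> tensor A A by rewrite tflip_tens.
rewrite f [k^-1 ⊗ _]f -!tflipM tflipK /twist_Delta /twist_map.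
rewrite !(wDeltaM hA) kl kVr.
have -> : (k * kappa k^-1) ⊗ k = (k ⊗ 1) ⊡ (kappa k^-1 ⊗ 1) ⊡ (1 ⊗ k).
  by rewrite !tmul_tens !mulr1 !mul1r.
rewrite -{1}(Delta1l hA (kappa a)) !tmulA -(tmulA _ (1 ⊗ k)).
have -> : (1 ⊗ k) ⊡ Delta 1 = (kappa k ⊗ 1) ⊡ Delta 1.
  exact (Delta1_target_l hA sxy Delta1E k_target).
rewrite !tmulA -(tmulA _ (kappa k^-1 ⊗ 1)) tmul_tens -(wkappaM hA) mulrV //.
rewrite (kappa1 hA) mulr1 tmult1 -!tmulA; congr (_ ⊡ (_ ⊡ _)).
by rewrite !tmulA (Delta1r hA) -tmulA tmul_tens mulr1 mul1r.
Qed.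

Lemma Delta_mul_target_leg a : Delta a ⊡ (k ⊗ 1) = Delta (a * k).
Proof. by rewrite (wDeltaM hA) [Delta k](proj1 k_target) tmulA (Delta1r hA). Qed.

Lemma twist_eps_linear : linear (ek : A -> F^o).
Proof. exact: comp_linear (weps_linear hA) (mul_linearl k). Qed.

(** The k inside ε_k is absorbed by Δ(a) (k ⊗ 1) = Δ(a k); the counit then yields a k, and the
    second leg supplies k^-1. *)
Lemma twist_counitl a : tlift (fun b c => ek b *: c) (Dk a) = a.
Proof.
have [b1 b2] := scale_bilin_l A (weps_linear hA).
have [b3 b4] := scale_bilin_l A twist_eps_linear.
have e t : tlift (fun b c => ek b *: c) (t ⊡ (1 ⊗ k^-1)) =
    tlift (fun b c => eps b *: c) (t ⊡ (k ⊗ 1)) * k^-1.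
  elim/tens_ind: t => [c t u Ht Hu|b c].
    by rewrite !tmul_linearl !tlift_linear Ht Hu mulrDl scalerAl.
  by rewrite !tmul_tens !mulr1 !tlift_tens ?scalerAl.
by rewrite e Delta_mul_target_leg (weps_counitl hA) mulrK.
Qed.

Lemma twist_counitr a : tlift (fun b c => ek c *: b) (Dk a) = a.
Proof.
have [b1 b2] := scale_bilin_r A (weps_linear hA).
have [b3 b4] := scale_bilin_r A twist_eps_linear.
rewrite -[RHS](weps_counitr hA) /twist_Delta.
elim/tens_ind: (Delta a) => [c t u Ht Hu|b c].
  by rewrite tmul_linearl !tlift_linear Ht Hu.
by rewrite !tmul_tens !mulr1 !tlift_tens ?mulrVK.
Qed.

Lemma twist_epsM a b :
  tlift (fun c d => (ek c * ek d : F^o)) ((a ⊗ 1) ⊡ Dk 1 ⊡ (1 ⊗ b)) = ek (a * b).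
Proof.
have le := weps_linear hA.
have bil f : linear (f : A -> F^o) ->
    bilin (fun c d : A => (f c * f d : F^o)).
  move=> lf; split=> [c e u v|c e u v] /=; rewrite lf.
    by rewrite mulrDr; congr (_ + _); rewrite mulrCA.
  by rewrite mulrDl; congr (_ + _); rewrite -mulrA.
have [b1 b2] := bil _ le.
have [b3 b4] := bil _ twist_eps_linear.
have e t : tlift (fun c d => (ek c * ek d : F^o)) t =
    tlift (fun c d => (eps c * eps d : F^o)) (t ⊡ (k ⊗ k)).
  elim/tens_ind: t => [c t u Ht Hu|c d].
    by rewrite !tmul_linearl !tlift_linear Ht Hu.
  by rewrite !tmul_tens !tlift_tens.
have [kr kl] := k_target; rewrite /target_leg in kr kl.
(* This splitting allows the axiom for ε to be used at a k and k^-1 b k. *)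
have -> : a * b * k = (a * k) * (k^-1 * b * k) by rewrite !mulrA mulrK.
rewrite e -(wepsM hA); congr tlift; rewrite /twist_Delta -!tmulA.
have -> : (1 ⊗ k^-1) ⊡ ((1 ⊗ b) ⊡ (k ⊗ k)) = (k ⊗ 1) ⊡ (1 ⊗ (k^-1 * b * k)).
  by rewrite !tmul_tens !mul1r mulr1 mulrA.
rewrite (tmulA (Delta 1)) -kr kl -tmulA (tmulA (a ⊗ 1)).
by rewrite tmul_tens mulr1.
Qed.

Theorem twist_weak_hopf : is_weak_hopf Dk kk kkinv ek.
Proof.
split.
- exact: Dk_linear.
- exact: twist_DeltaM.
- exact: twist_coassoc.
- exact: kk_linear.
- move=> a; rewrite /twist_map !mulrA mulVr // mul1r mulrVK //.
  exact: wkappaK hA a.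
- by move=> a; rewrite /twist_map (wkinvK hA) !mulrA mulrV // mul1r mulrK.
- by move=> a b; rewrite /twist_map (wkappaM hA) !mulrA mulrVK.
- exact: twist_kappa_Delta.
- exact: twist_antipode.
- exact: twist_eps_linear.
- exact: twist_counitl.
- exact: twist_counitr.
- exact: twist_epsM.
Qed.

(** * Cartan subalgebras and canonical form of the twisted structure *)

Lemma twist_legK : cancel (fun t : tensor A A => t ⊡ (1 ⊗ k^-1))
  (fun t => t ⊡ (1 ⊗ k)).
Proof. by move=> t; rewrite -tmulA tmul_tens mulr1 mulVr // tmult1. Qed.

Lemma twist_target : leg_cartan Dk (@target_leg F A) = At.
Proof.
apply/funext => a; apply/propext; rewrite /leg_cartan /=.
have er : Dk 1 ⊡ target_leg a = (Delta 1 ⊡ target_leg a) ⊡ (1 ⊗ k^-1).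
  by rewrite -!tmulA !tmul_tens !mulr1 !mul1r.
rewrite er tmulA /twist_Delta; split=> [[ar al]|[<- <-] //].
by split; apply: (can_inj twist_legK).
Qed.

(** In the left equation 1 ⊗ k^-1 stands at the right end and cancels; [source_of_left] supplies the
    other equation. Conversely, elements of A_s commute with k^-1, which lies in A_t. *)
Lemma twist_source : leg_cartan Dk (@source_leg F A) = As.
Proof.
apply/funext => a; apply/propext; rewrite /leg_cartan /=; split=> [[_]|].
  rewrite tmulA => /(can_inj twist_legK) al.
  exact (source_of_left hA sxy q_target Delta1E al).
move=> Na; have [ar al] := Na; split; last by rewrite tmulA -al.
rewrite /twist_Delta ar -!tmulA !tmul_tens !mulr1.
by rewrite (target_source_comm hA kV_target Na).
Qed.

(** Sliding k^-1 from y_i to x_i gives κ^-1(k^-1 x_i q), which is the twisted inverse antipode at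
    x_i k^-1 q since k commutes with q. *)
Lemma twist_Delta1E : Dk 1 = \sum_i kkinv (x i * (k^-1 * q)) ⊗ y i.
Proof.
have lid := @id_linear F A.
have lk : linear (fun a => a * q).
  exact: mul_linearl.
have bB := kinv_bilin hA lk lid.
rewrite /twist_Delta Delta1E tmul_suml.
under eq_bigr => i _ do rewrite tmul_tens mulr1.
rewrite -(sep_bilin_outer sxy kV_target bB); apply: eq_bigr => i _.
by rewrite twist_comm -!mulrA mulVr // mulr1.
Qed.

End Twist.

(** * Matrix units *)

Definition mxu_index (T : Type) (e : mxfamily T) : finType :=
  {g : 'I_(nblocks e) & ('I_(bdim e g) * 'I_(bdim e g))%type}.

(** The whole weight 1/n_g sits on the left factor, and [mxu_r] has its indices transposed, so
    summing [mxu_l] ⊗ [mxu_r] gives Σ 1/n_g e_ij ⊗ e_ji. *)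
Definition mxu_l (F : fieldType) (A : falgType F) (e : mxfamily A)
    (s : mxu_index e) : A :=
  (bdim e (tag s))%:R^-1 *: mxu e (tag s) (tagged s).1 (tagged s).2.

Definition mxu_r (T : Type) (e : mxfamily T) (s : mxu_index e) : T :=
  mxu e (tag s) (tagged s).2 (tagged s).1.

Arguments mxu_l {F A} e s.
Arguments mxu_r {T} e s.

Section MatrixUnits.
Variables (F : fieldType) (A : falgType F) (N : set A) (e : mxfamily A).
Hypothesis bdim_neq0 : forall g, (bdim e g)%:R != 0 :> F.
Hypothesis N_scale : forall c a, N a -> N (c *: a).
Hypothesis e_in : forall g i j, N (mxu e g i j).
Hypothesis e_mul : forall g i j k l,
  mxu e g i j * mxu e g k l = if j == k then mxu e g i l else 0.
Hypothesis e_mul0 : forall g h i j k l,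
  g != h -> mxu e g i j * mxu e h k l = 0.
Hypothesis e_sum1 : \sum_g \sum_i mxu e g i i = 1.
Hypothesis e_span : forall x, N x ->
  exists c : forall g, 'I_(bdim e g) -> 'I_(bdim e g) -> F,
    x = \sum_g \sum_i \sum_j c g i j *: mxu e g i j.

Lemma mxu_sumE (V : zmodType) (f : A -> A -> V) :
  \sum_(s : mxu_index e) f (mxu_l e s) (mxu_r e s) =
  \sum_g \sum_(i < bdim e g) \sum_(j < bdim e g)
    f ((bdim e g)%:R^-1 *: mxu e g i j) (mxu e g j i).
Proof.
under [RHS]eq_bigr => g _ do rewrite pair_bigA.
by rewrite sig_big_dep.
Qed.

Lemma canonical_sumE (f g : A -> A) (q : A) : linear g -> f =1 g ->
  \sum_g \sum_(i < bdim e g) \sum_(j < bdim e g)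
    (bdim e g)%:R^-1 *: (f (mxu e g i j * q) ⊗ mxu e g j i) =
  \sum_s g (mxu_l e s * q) ⊗ mxu_r e s.
Proof.
move=> lf fg; rewrite (mxu_sumE (fun a b => g (a * q) ⊗ b)).
apply: eq_bigr => h _; apply: eq_bigr => i _; apply: eq_bigr => j _.
by rewrite fg -scalerAl (linear_funZ _ _ lf) (linear_funZ _ _ (tens_linearl _)).
Qed.

Lemma expectation_sumE (n : A) :
  \sum_g \sum_(i < bdim e g) \sum_(j < bdim e g)
    (bdim e g)%:R^-1 *: (mxu e g i j * n * mxu e g j i) =
  \sum_s mxu_l e s * n * mxu_r e s.
Proof.
rewrite (mxu_sumE (fun a b => a * n * b)).
apply: eq_bigr => g _; apply: eq_bigr => i _; apply: eq_bigr => j _.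
by rewrite -!scalerAl.
Qed.

(** Both sums reduce to 1/n_h Σ_j e_kj ⊗ e_jl in block h. *)
Lemma mxu_outer h k l :
  \sum_s (mxu e h k l * mxu_l e s) ⊗ mxu_r e s =
  \sum_s mxu_l e s ⊗ (mxu_r e s * mxu e h k l).
Proof.
rewrite (mxu_sumE (fun a b => (mxu e h k l * a) ⊗ b)).
rewrite (mxu_sumE (fun a b => a ⊗ (b * mxu e h k l))).
rewrite (bigD1 h) // [RHS](bigD1 h) //=.
rewrite [X in _ + X]big1 => [|g gh]; last first.
  rewrite big1 // => i _; rewrite big1 // => j _.
  by rewrite -scalerAr e_mul0 1?eq_sym // scaler0 tens0l.
rewrite [X in _ = _ + X]big1 => [|g gh]; last first.
  by rewrite big1 // => i _; rewrite big1 // => j _; rewrite e_mul0 // tens0r.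
congr (_ + _); rewrite (bigD1 l) // [RHS](bigD1 k) //=.
rewrite [X in _ + X]big1 => [|i il]; last first.
  by rewrite big1 // => j _; rewrite -scalerAr e_mul eq_sym (negPf il) scaler0 tens0l.
rewrite [X in _ = _ + X]big1 => [|i ik]; last first.
  by rewrite big1 // => j _; rewrite e_mul (negPf ik) tens0r.
by congr (_ + _); apply: eq_bigr => j _; rewrite -scalerAr !e_mul !eqxx.
Qed.

(** Both sums reduce to 1/n_h Σ_i e_il ⊗ e_ki in block h. *)
Lemma mxu_inner h k l :
  \sum_s (mxu_l e s * mxu e h k l) ⊗ mxu_r e s =
  \sum_s mxu_l e s ⊗ (mxu e h k l * mxu_r e s).
Proof.
rewrite (mxu_sumE (fun a b => (a * mxu e h k l) ⊗ b)).
rewrite (mxu_sumE (fun a b => a ⊗ (mxu e h k l * b))).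
apply: eq_bigr => g _.
have [->|gh] := eqVneq g h; last first.
  rewrite !big1 // => i _; rewrite big1 // => j _.
    by rewrite e_mul0 ?tens0r 1?eq_sym.
  by rewrite -scalerAl e_mul0 // scaler0 tens0l.
apply: eq_bigr => i _; rewrite (bigD1 k) // [RHS](bigD1 l) //=.
rewrite [X in _ + X]big1 => [|j jk]; last first.
  by rewrite -scalerAl e_mul (negPf jk) scaler0 tens0l.
rewrite [X in _ = _ + X]big1 => [|j jl]; last first.
  by rewrite e_mul eq_sym (negPf jl) tens0r.
by rewrite -scalerAl !e_mul !eqxx.
Qed.

Lemma mxu_sep : is_sep_family N (mxu_l e) (mxu_r e).
Proof.
have ext (f g : A -> tensor A A) : linear f -> linear g ->
    (forall h k l, f (mxu e h k l) = g (mxu e h k l)) ->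
    forall a, N a -> f a = g a.
  move=> lf lg fg a /e_span [c ->].
  do 3!(rewrite (linear_sum_fun _ lf) (linear_sum_fun _ lg);
        apply: eq_bigr => ? _).
  by rewrite (linear_funZ _ _ lf) (linear_funZ _ _ lg) fg.
have lsum (I : finType) (f : I -> A -> tensor A A) : (forall i, linear (f i)) ->
    linear (fun a => \sum_i f i a).
  move=> lf c u v; rewrite scaler_sumr -big_split.
  by apply: eq_bigr => i _; rewrite lf.
split=> [s|s||||].
- by apply: N_scale; apply: e_in.
- exact: e_in.
- apply: ext => [||h k l]; last exact: mxu_outer.
    apply: lsum => s; apply: comp_linear (tens_linearl _) _.
    exact: mul_linearl.
  apply: lsum => s; apply: comp_linear (tens_linearr _) _.
  exact: mul_linearr.
- apply: ext => [||h k l]; last exact: mxu_inner.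
    apply: lsum => s; apply: comp_linear (tens_linearl _) _.
    exact: mul_linearr.
  apply: lsum => s; apply: comp_linear (tens_linearr _) _.
  exact: mul_linearl.
- rewrite (mxu_sumE (fun a b => a * b)) -[RHS]e_sum1.
  apply: eq_bigr => g _; apply: eq_bigr => i _.
  under eq_bigr => j _ do rewrite -scalerAl e_mul eqxx.
  by rewrite sumr_const card_ord -scaler_nat scalerA mulfV ?scale1r.
- rewrite (mxu_sumE (fun a b => b * a)) -[RHS]e_sum1.
  apply: eq_bigr => g _; rewrite exchange_big; apply: eq_bigr => i _ /=.
  under eq_bigr => j _ do rewrite -scalerAr e_mul eqxx.
  by rewrite sumr_const card_ord -scaler_nat scalerA mulfV ?scale1r.
Qed.

End MatrixUnits.

(** * Positive square roots *)

Lemma prod_XsubC_annihilates (C : closedFieldType) (A : falgType C) (k : A) :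
  exists s : seq C, horner_alg k (\prod_(r <- s) ('X - r%:P)) = 0.
Proof.
pose d := dim A.
have lf : linear (fun v : 'rV[C]_d.+1 => horner_alg k (rVpoly v)).
  by move=> c u v; rewrite linearP rmorphD /= linearZ /= mulr_algl.
pose fL : {linear 'rV[C]_d.+1 -> A} :=
  HB.pack (fun v : 'rV[C]_d.+1 => horner_alg k (rVpoly v))
    (GRing.isLinear.Build C _ A *:%R _ lf).
have kf : lker (linfun fL) != 0%VS.
  apply/negP => /eqP kf0; have := limg_ker_dim (linfun fL) fullv.
  rewrite kf0 capv0 dimv0 add0n dimvf /dim /= mul1n => e.
  have := dimvS (subvf (linfun fL @: fullv)%VS).
  by rewrite e dimvf /dim /= ltnn.
pose v := vpick (lker (linfun fL)).
have v0 : v != 0 by rewrite vpick0.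
have : linfun fL v = 0 by apply/eqP; rewrite -memv_ker memv_pick.
rewrite lfunE /=; set p := rVpoly v => p0.
have pn0 : p != 0.
  by apply: contra v0 => /eqP p00; rewrite -[v]rVpolyK -/p p00 linear0.
have [s sE] := closed_field_poly_normal p; exists s.
move: p0; rewrite sE linearZ /= mulr_algl => /eqP.
by rewrite scaler_eq0 lead_coef_eq0 (negPf pn0) => /eqP.
Qed.

Lemma interpolation (F : fieldType) (s : seq F) (f : F -> F) :
  uniq s -> exists p : {poly F}, forall r, r \in s -> p.[r] = f r.
Proof.
elim: s => [|a s IH] /=; first by exists 0.
move=> /andP[as_ us]; have [p pE] := IH us.
pose Q := \prod_(r <- s) ('X - r%:P).
have Qa : Q.[a] != 0 by rewrite -[_ == 0]/(root Q a) root_prod_XsubC.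
(* Newton step: Q vanishes on s, so adding a multiple of it corrects the value at a alone. *)
exists (p + ((f a - p.[a]) / Q.[a]) *: Q) => r; rewrite inE !hornerE.
case/predU1P => [->|rs]; first by rewrite mulfVK // addrC subrK.
have /eqP -> : root Q r by rewrite root_prod_XsubC.
by rewrite mulr0 addr0 pE.
Qed.

(** * Square roots from a positive form that is faithful on a subalgebra *)

Section PositiveForm.
Variables (C : numClosedFieldType) (A : falgType C) (star : A -> A).
Variable eps : A -> C.
Hypothesis starK : involutive star.
Hypothesis starD : forall x y, star (x + y) = star x + star y.
Hypothesis starZ : forall c x, star (c *: x) = c^* *: star x.
Hypothesis starM : forall x y, star (x * y) = star y * star x.
Hypothesis eps_linear : linear (eps : A -> C^o).
Hypothesis eps_positive : forall x, 0 <= eps (star x * x).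

Let epsZ c x : eps (c *: x) = c * eps x.
Proof. exact: (linear_funZ c x eps_linear). Qed.

Let epsD x y : eps (x + y) = eps x + eps y.
Proof. by have := eps_linear 1 x y; rewrite !scale1r. Qed.

(* Degenerate Cauchy-Schwarz: test positivity on t a^* + x at
   t = - eps (a x) / (eps (a a^* ) + 1). *)
Lemma positive_form_null x a : eps (star x * x) = 0 -> eps (a * x) = 0.
Proof.
move=> x0; pose u := star a.
pose M := eps (star u * u); pose B := eps (star u * x); pose D := eps (star x * u).
have M0 : 0 <= M by apply: eps_positive.
have pos t : 0 <= t^* * t * M + t^* * B + t * D.
  have := eps_positive (t *: u + x).
  rewrite starD starZ mulrDl !mulrDr -!scalerAl -!scalerAr !epsD !epsZ x0 addr0.
  by rewrite -/M -/B -/D !mulrA.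
have real t : t^* * B + t * D \is Num.real.
  have /ger0_real h := pos t; have /ger0_real h' : 0 <= t^* * t * M.
    by rewrite mulr_ge0 // mulrC mul_conjC_ge0.
  have -> : t^* * B + t * D = t^* * t * M + t^* * B + t * D - t^* * t * M.
    by ring.
  by rewrite rpredB.
(* Realness of t^* B + t D at t = 1 and t = i. *)
have DB : D = B^*.
  have := conj_Creal (real 1); have := conj_Creal (real 'i).
  rewrite !(rmorphD, rmorphM) /= !conjCK !conjC1 !conjCi !mul1r => e1 e2.
  have : 'i * (B^* - D^*) = 'i * (D - B).
    by rewrite mulrBr mulrBr -!mulNr e1 addrC.
  move/(mulfI (neq0Ci _)) => e3.
  have e4 : 2 * D = 2 * B^*.
    by transitivity ((B + D) + (D - B)); [ring | rewrite -e2 -e3; ring].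
  by apply: mulfI e4; rewrite pnatr_eq0.
have M1 : 0 < M + 1 by rewrite ltr_wpDl.
have sr : ((M + 1)^-1)^* = (M + 1)^-1.
  by rewrite conj_Creal // ger0_real // invr_ge0 ltW.
have := pos (- (M + 1)^-1 * B); rewrite DB rmorphM rmorphN /= sr.
have -> : - (M + 1)^-1 * B^* * (- (M + 1)^-1 * B) * M
    + - (M + 1)^-1 * B^* * B + - (M + 1)^-1 * B * B^*
    = - ((M + 1)^-1 ^+ 2 * (M + 2) * (B * B^*)).
  by field; rewrite gt_eqF.
rewrite oppr_ge0 pmulr_rle0; last first.
  by rewrite mulr_gt0 ?exprn_gt0 ?invr_gt0 // ltr_wpDl.
move=> BB; have : B * B^* == 0 by rewrite eq_le BB mul_conjC_ge0.
by rewrite mul_conjC_eq0 /B /u starK => /eqP.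
Qed.

Variables (N : set A) (k b : A).
Hypothesis N1 : N 1.
Hypothesis N_linear : forall c x y, N x -> N y -> N (c *: x + y).
Hypothesis NM : forall x y, N x -> N y -> N (x * y).
Hypothesis eps_faithful : forall x, N x -> eps (star x * x) = 0 -> x = 0.
Hypothesis Nk : N k.
Hypothesis kE : k = star b * b.
Hypothesis k_unit : k \is a GRing.unit.

Let starZ1 c : star c%:A = c^* %:A.
Proof.
have s1 : star 1 = 1 
  by rewrite -[RHS]starK -[star 1 in RHS]mulr1 starM starK mulr1.
by rewrite starZ s1.
Qed.

Let star_k : star k = k. Proof. by rewrite kE starM starK. Qed.

Lemma horner_alg_in p : N (horner_alg k p).
Proof.
have N0 : N 0 by have := N_linear (-1) N1 N1; rewrite scaleN1r addNr.
elim/poly_ind: p => [|p c Np]; first by rewrite rmorph0.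
rewrite rmorphD rmorphM /= horner_algX horner_algC addrC.
exact/N_linear/NM.
Qed.

Lemma star_horner_alg p : star (horner_alg k p) = horner_alg k (map_poly Num.conj p).
Proof.
elim/poly_ind: p => [|p c IH].
  by rewrite !rmorph0 -[0](scale0r (1 : A)) starZ1 conjC0.
rewrite !(rmorphD, rmorphM) /= map_polyX map_polyC /= !horner_algX !horner_algC.
by rewrite starD starM starZ1 star_k IH -{1 4}(horner_algX k) -!rmorphM /= mulrC.
Qed.

Let P s := horner_alg k (\prod_(r <- s) ('X - r%:P)).

Lemma P_cons r s : P (r :: s) = (k - r%:A) * P s.
Proof.
by rewrite /P big_cons rmorphM rmorphB /= horner_algX horner_algC.
Qed.

Lemma P_perm r s : r \in s -> P s = (k - r%:A) * P (rem r s).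
Proof.
by move=> rs; rewrite -P_cons /P; congr horner_alg; apply/perm_big/perm_to_rem.
Qed.

(** x = [P s] is an eigenvector for left multiplication by k, and r ε(x^* x) = ε(x^* k x) = ε((b
    x)^* b x) is nonnegative. Faithfulness makes ε(x^* x) positive, and r = 0 would contradict
    invertibility of k. *)
Lemma eigenvalue_gt0 r s : P s != 0 -> (k - r%:A) * P s = 0 -> 0 < r.
Proof.
set x := P s => x0 /eqP; rewrite mulrBl subr_eq0 mulr_algl => /eqP kx.
have px : 0 < eps (star x * x).
  rewrite lt0r eps_positive andbT; apply: contra x0 => /eqP ex.
  exact/eqP/(eps_faithful (horner_alg_in _)).
rewrite lt0r; apply/andP; split.
  apply: contra x0 => /eqP r0; rewrite r0 scale0r in kx.
  by rewrite -[x](mulKr k_unit) kx mulr0.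
rewrite -(pmulr_lge0 _ px) -epsZ scalerAr -kx kE !mulrA -starM.
by rewrite -mulrA eps_positive.
Qed.

(** Take a list from which no root can be removed; each root is then an eigenvalue, hence positive.
    If r occurred twice, y = [P (rem r s)] would contain the selfadjoint factor k - r, so y^* y
    would contain [P s] = 0 and faithfulness would give y = 0, against minimality. *)
Lemma positive_annihilator :
  exists s : seq C, [/\ P s = 0, uniq s & forall r, r \in s -> 0 < r].
Proof.
have [s] := prod_XsubC_annihilates k; rewrite -/(P s).
have [n] := ubnP (size s); elim: n s => // n IH s; rewrite ltnS => sn Ps.
case: (boolP (has (fun r => P (rem r s) == 0) s)) => [/hasP[r rs /eqP Pr]|].
  apply: IH Pr; rewrite size_rem // prednK //.
  by case: (s) rs.
move=> /hasPn min; exists s.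
have pos r : r \in s -> 0 < r.
  by move=> rs; apply: (eigenvalue_gt0 (min r rs)); rewrite -P_perm.
split=> //; apply: count_mem_uniq => r.
have [rs|rs] := boolP (r \in s); last by apply/count_memPn.
have := perm_to_rem rs => /permP -> /=; rewrite eqxx.
suff : r \notin rem r s by move/count_memPn => ->.
apply/negP => rrs; have := min r rs.
have ys : P (rem r s) = (k - r%:A) * P (rem r (rem r s)) by rewrite -P_perm.
have rr : r^* = r by rewrite conj_Creal // gtr0_real // pos.
have : star (P (rem r s)) * P (rem r s) = 0.
  rewrite {1}ys starM starD -scaleN1r starZ starZ1 rr rmorphN1 scaleN1r.
  by rewrite star_k -mulrA -P_perm // Ps mulr0.
move=> yy; case/negP; apply/eqP/eps_faithful; first exact: horner_alg_in.
by rewrite yy -[0](scale0r (1 : A)) epsZ mul0r.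
Qed.

Lemma positive_sqrt :
  exists c, [/\ N c, c \is a GRing.unit & k = c * star c].
Proof.
have [s [Ps us pos]] := positive_annihilator.
(* The roots and their square roots are real, so L times its conjugate agrees with X at each root.
   The roots being distinct, the difference is a multiple of the annihilating product. *)
have [L LE] := interpolation sqrtC us.
have kc : k = horner_alg k L * star (horner_alg k L).
  rewrite star_horner_alg -rmorphM /=; apply/esym/eqP.
  rewrite -[X in _ == X](horner_algX k) -subr_eq0 -rmorphB /=.
  have /dvdpP[Q ->] : \prod_(r <- s) ('X - r%:P) %| L * (map_poly Num.conj L) - 'X.
    apply: uniq_roots_dvdp; last by rewrite uniq_rootsE.
    apply/allP => r rs; have r0 := pos r rs.
    rewrite /root !hornerE -{2}[r]conj_Creal ?gtr0_real // horner_map /= LE //.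
    by rewrite conj_Creal ?ger0_real ?sqrtC_ge0 ?ltW // -expr2 sqrtCK subrr.
  by rewrite rmorphM /= -/(P s) Ps mulr0.
exists (horner_alg k L); split=> //; first exact: horner_alg_in.
(* Both factors are polynomials in k, hence commute, so each is invertible with the product. *)
move: k_unit; rewrite {1}kc unitrM_comm; first by case/andP.
by rewrite star_horner_alg /GRing.comm -!rmorphM mulrC.
Qed.

End PositiveForm.

(** * The involution *)

Section Groupoid.
Variables (R : realType) (A : falgType R[i]).
Variables (star : A -> A) (Delta : A -> tensor A A) (kappa : A -> A).
Variable eps : A -> R[i].
Hypothesis hA : is_quantum_groupoid star Delta kappa eps.

Let cs := qg_cstar hA.
Local Notation At := (target_cartan Delta).
Local Notation kinv := (fun z => star (kappa (star z))).

(** The axiom [kappa_star] says that [kinv] is a right inverse of κ; applying [star] shows that it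
    is also a left inverse. *)
Lemma groupoid_kappaK : cancel kappa kinv.
Proof.
move=> x; apply: (can_inj (starK cs)).
by rewrite (starK cs) -[x in LHS](starK cs) (kappa_star hA).
Qed.

Lemma groupoid_weak_hopf : is_weak_hopf Delta kappa kinv eps.
Proof.
exact (Build_is_weak_hopf (Delta_linear hA) (DeltaM hA) (Delta_coassoc hA)
  (kappa_linear hA) groupoid_kappaK (kappa_star hA) (kappaM hA)
  (kappa_Delta hA) (kappa_antipode hA) (eps_linear hA) (eps_counitl hA)
  (eps_counitr hA) (epsM hA)).
Qed.

(** Positivity gives ε(a x) = 0 for every a, and x is recovered by applying ε to the first leg of
    Δ(1) (x ⊗ 1). *)
Lemma eps_faithful_target x : At x -> eps (star x * x) = 0 -> x = 0.
Proof.
move=> [xr xl] ex; rewrite -[LHS](eps_counitl hA) xr.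
have [b1 b2] := scale_bilin_l A (eps_linear hA).
have null a : eps (a * x) = 0.
  exact (positive_form_null (starK cs) (starD cs) (starZ cs)
    (eps_linear hA) (eps_positive hA) a ex).
elim/tens_ind: (Delta 1) => [c t u Ht Hu|a b].
  by rewrite tmul_linearl tlift_linear Ht Hu scaler0 addr0.
by rewrite tmul_tens tlift_tens // null scale0r.
Qed.

(** The involution [st] is left free, so the lemma applies to matrix units for the original and for
    the twisted involution. *)
Lemma target_mxunits_sep st e :
  is_mxunits st At e -> is_sep_family At (mxu_l e) (mxu_r e).
Proof.
move=> he; apply: mxu_sep.
- by move=> g; rewrite pnatr_eq0 -lt0n (bdim_gt0 he).
- by move=> c a Na; exact (targetZ groupoid_weak_hopf c Na).
- exact: mxu_in he.
- exact: mxu_mul he.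
- exact: mxu_mul0 he.
- exact: mxu_sum1 he.
- exact: mxu_span he.
Qed.

End Groupoid.

(** * Transport of structure to the twisted involution *)

Lemma twist_cstar (R : realType) (A : falgType R[i]) (star : A -> A) (c k : A) :
  is_cstar_algebra star -> c \is a GRing.unit -> k = c * star c ->
  is_cstar_algebra (twist_map star k).
Proof.
move=> cs cu kE; have scu := star_unit cs cu.
have ku : k \is a GRing.unit by rewrite kE unitrMl.
have sk : star k = k by rewrite kE (starM cs) (starK cs).
split.
- move=> x; rewrite /twist_map !(starM cs) (starK cs) (starV cs) // sk.
  by rewrite !mulrA mulrV // mul1r mulrK.
- by move=> x y; rewrite /twist_map (starD cs) mulrDr mulrDl.
- by move=> d x; rewrite /twist_map (starZ cs) -scalerAr -scalerAl.
- move=> x y; rewrite /twist_map (starM cs) !mulrA mulrVK //.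
(* As k = c c^*, the map x ↦ c^-1 x c carries the twisted involution to [star], so the norm is
   pulled back along it. *)
have [N hN] := star_cnorm cs; exists (fun x => N (c^-1 * x * c)).
split.
- move=> x /(cnorm_eq0 hN) x0.
  have -> : x = c * (c^-1 * x * c) * c^-1 by rewrite !mulrA mulrV // mul1r mulrK.
  by rewrite x0 mulr0 mul0r.
- by move=> x y; rewrite mulrDr mulrDl; apply: (cnormD hN).
- by move=> d x; rewrite -scalerAr -scalerAl (cnormZ hN).
- move=> x y; have -> : c^-1 * (x * y) * c = (c^-1 * x * c) * (c^-1 * y * c).
    by rewrite !mulrA mulrK.
  exact: (cnormM hN).
- move=> x; rewrite -(cnorm_star hN); congr N.
  rewrite /twist_map !(starM cs) (starV cs) // kE invrM // !mulrA.
  by rewrite mulVr // mul1r.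
Qed.

Definition conj_mxfamily (T : unitRingType) (c : T) (e : mxfamily T) : mxfamily T :=
  MxFamily (fun g i j => c * mxu e g i j * c^-1).

(** Guarantees that A_t has matrix units for the twisted involution; without any, the formula in
    [canonical_spec] would hold vacuously and could not determine the canonical element. *)
Lemma conj_mxunits (R : realType) (A : falgType R[i]) (star : A -> A)
    (N : set A) (c k : A) (e : mxfamily A) :
  is_cstar_algebra star -> c \is a GRing.unit -> k = c * star c ->
  (forall x y, N x -> N y -> N (x * y)) -> N c -> N c^-1 ->
  is_mxunits star N e -> is_mxunits (twist_map star k) N (conj_mxfamily c e).
Proof.
move=> cs cu kE NM Nc Ncv he; have scu := star_unit cs cu.
have cM a b : (c * a * c^-1) * (c * b * c^-1) = c * (a * b) * c^-1.
  by rewrite !mulrA mulrVK.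
split=> /=.
- exact: bdim_gt0 he.
- by move=> g i j; apply: (NM _ _ (NM _ _ Nc (mxu_in he i j)) Ncv).
- move=> g i j; apply: contra (mxu_neq0 he i j) => /eqP e0.
  have -> : mxu e g i j = c^-1 * (c * mxu e g i j * c^-1) * c.
    by rewrite !mulrA mulVr // mul1r mulrVK.
  by rewrite e0 mulr0 mul0r.
- move=> g i j l m; rewrite cM (mxu_mul he); case: (j == l) => //.
  by rewrite mulr0 mul0r.
- by move=> g h i j l m gh; rewrite cM (mxu_mul0 he) // mulr0 mul0r.
- move=> g i j; rewrite /twist_map !(starM cs) (starV cs) // (mxu_star he).
  by rewrite kE invrM // !mulrA mulrK // mulrK.
- under eq_bigr => g _ do rewrite -mulr_suml -mulr_sumr.
  by rewrite -mulr_suml -mulr_sumr (mxu_sum1 he) mulr1 mulrV.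
- move=> x Nx; have [d dE] := mxu_span he (NM _ _ (NM _ _ Ncv Nx) Nc).
  exists d.
  have -> : x = c * (c^-1 * x * c) * c^-1 by rewrite !mulrA mulrV // mul1r mulrK.
  rewrite dE.
  do 3!(rewrite mulr_sumr mulr_suml; apply: eq_bigr => ? _).
  by rewrite -scalerAr -scalerAl.
Qed.

Lemma tstar_twist (R : realType) (A : falgType R[i]) (star : A -> A) (k : A) t :
  is_cstar_algebra star -> is_cstar_algebra (twist_map star k) ->
  tstar (twist_map star k) t = (k ⊗ k) ⊡ tstar star t ⊡ (k^-1 ⊗ k^-1).
Proof.
move=> cs ck; elim/tens_ind: t => [c t u Ht Hu|a b].
  by rewrite !tstar_antilinear tmul_linearr tmul_linearl Ht Hu.
by rewrite !tstar_tens // !tmul_tens.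
Qed.

(** Used with T = [tstar star]. Both sides equal (k ⊗ 1) Δ(f(a)) (k^-1 ⊗ k^-1): on the left because
    k and k^-1 lie in A_t, on the right because (k ⊗ k) (1 ⊗ k^-1) = k ⊗ 1. *)
Lemma twist_Delta_antimorph (F : fieldType) (A : falgType F)
    (Delta : A -> tensor A A) (f : A -> A) (T : tensor A A -> tensor A A)
    (k a : A) :
  (forall x y, Delta (x * y) = Delta x ⊡ Delta y) ->
  (forall x y, T (x ⊡ y) = T y ⊡ T x) ->
  (forall x, Delta (f x) = T (Delta x)) ->
  T (1 ⊗ k^-1) = 1 ⊗ k^-1 ->
  k \is a GRing.unit ->
  leg_cartan Delta (@target_leg F A) k ->
  leg_cartan Delta (@target_leg F A) k^-1 ->
  twist_Delta Delta k (twist_map f k a) =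
  (k ⊗ k) ⊡ T (twist_Delta Delta k a) ⊡ (k^-1 ⊗ k^-1).
Proof.
move=> DM TM Df Tk ku [_ kl] [kr _].
rewrite /twist_Delta /twist_map TM Tk -Df !DM kl kr /target_leg.
have D1l x : Delta 1 ⊡ Delta x = Delta x by rewrite -DM mul1r.
have D1r x : Delta x ⊡ Delta 1 = Delta x by rewrite -DM mulr1.
rewrite -!tmulA (tmulA (Delta 1) (Delta _)) D1l (tmulA (Delta (f a))) D1r.
by rewrite (tmulA (k ⊗ k)) !tmul_tens !mulr1 mul1r mulrV.
Qed.

Lemma twist_kappa_star (T : unitRingType) (star kappa : T -> T) (k : T) :
  (forall x y, star (x * y) = star y * star x) ->
  (forall x y, kappa (x * y) = kappa y * kappa x) ->
  (forall x, kappa (star (kappa (star x))) = x) ->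
  k \is a GRing.unit -> star k = k -> star k^-1 = k^-1 ->
  forall x, twist_map kappa k (twist_map star k
    (twist_map kappa k (twist_map star k x))) = x.
Proof.
move=> sM kM ks ku sk skV x.
have kk1 : kappa (star (kappa k)) = k by rewrite -{1}sk ks.
have kkV : kappa (star (kappa k^-1)) = k^-1 by rewrite -{1}skV ks.
rewrite /twist_map !(sM, kM) sk skV !(mulrA, sM, kM) kk1 kkV ks.
have k1 : kappa k^-1 * kappa k = 1.
  by rewrite -kM mulrV // -[LHS]mulr1 -{2}(ks 1) -kM mulr1 ks.
have k1K z : z * kappa k^-1 * kappa k = z by rewrite -mulrA k1 mulr1.
by rewrite !k1K mulrV // mul1r mulrK.
Qed.

(** Reduces positivity of the twisted counit to that of ε at c^-1 a c c^*. *)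
Lemma twist_square (T : unitRingType) (star : T -> T) (c k a : T) :
  (forall x y, star (x * y) = star y * star x) -> involutive star ->
  c \is a GRing.unit -> star c \is a GRing.unit ->
  star c^-1 = (star c)^-1 -> k = c * star c ->
  k * star a * k^-1 * a * k =
  star (c^-1 * a * c * star c) * (c^-1 * a * c * star c).
Proof.
move=> sM sK cu scu sV ->.
by rewrite !sM sK sV invrM // !mulrA.
Qed.

Theorem theorem2p6 (R : realType) (A : falgType R[i])
    (star : A -> A) (Delta : A -> tensor A A) (kappa : A -> A) (eps : A -> R[i])
    (q k : A)
    (hA : is_quantum_groupoid star Delta kappa eps)
    (hq : is_canonical_element star Delta kappa q)
    (k_target : target_cartan Delta k)
    (k_pos : cstar_positive star k)
    (k_unit : k \is a GRing.unit)
    (k_kappa2 : kappa (kappa k) = k)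
    (k_expect : center_expectation star (target_cartan Delta) (k^-1 * q) = 1) :
  let star_k := fun a : A => k * star a * k^-1 in
  let Delta_k := fun a : A => Delta a ⊡ (1 ⊗ k^-1) in
  let kappa_k := fun a : A => k * kappa a * k^-1 in
  let eps_k := fun a : A => eps (a * k) in
  [/\ is_quantum_groupoid star_k Delta_k kappa_k eps_k,
      target_cartan Delta_k = target_cartan Delta,
      source_cartan Delta_k = source_cartan Delta &
      is_canonical_element star_k Delta_k kappa_k (k^-1 * q)].
Proof.
rewrite -[fun a => k * star a * _]/(twist_map star k).
rewrite -[fun a => k * kappa a * _]/(twist_map kappa k).
rewrite -[fun a => Delta a ⊡ _]/(twist_Delta Delta k) => sk Dk kk ek.
have cs := qg_cstar hA; have hW := groupoid_weak_hopf hA.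
have [[q_target q_unit qE] _] := hq.
have kV_target := targetV hW k_unit k_target.
have [b kE] := k_pos.
have [c [Nc cu kc]] := positive_sqrt (starK cs) (starD cs) (starZ cs)
  (starM cs) (eps_linear hA) (eps_positive hA) (target1 Delta)
  (target_linear hW) (targetM hW) (eps_faithful_target hA) k_target kE k_unit.
have star_k : star k = k by rewrite kE (starM cs) (starK cs).
have star_kV : star k^-1 = k^-1 by rewrite (starV cs) // star_k.
(* The default value of [center_expectation] is 0, so the value 1 ensures that some system of matrix
   units exists and computes it. *)
have [e0 he0 e0E] : exists2 e, is_mxunits star (target_cartan Delta) e &
    1 = \sum_g \sum_(i < bdim e g) \sum_(j < bdim e g)
      (bdim e g)%:R^-1 *: (mxu e g i j * (k^-1 * q) * mxu e g j i).
  move: k_expect; rewrite /center_expectation.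
  case: xgetP => [z _ [e he zE] z1|_ /esym/eqP].
    exact (ex_intro2 _ _ e he (etrans (esym z1) zE)).
  by rewrite oner_eq0.
have sep0 := target_mxunits_sep hA he0.
have D1 := qE _ he0.
rewrite (canonical_sumE e0 q (wkinv_linear hW)
  (linfun_invE (kappa_linear hA) (wkappaK hW))) in D1.
rewrite expectation_sumE in e0E.
have hWk := twist_weak_hopf hW sep0 q_target D1 k_target k_unit k_kappa2
  (esym e0E).
have ck : is_cstar_algebra sk := twist_cstar cs cu kc.
have tE : target_cartan Dk = target_cartan Delta.
  exact (twist_target Delta k_unit).
have sepk e : is_mxunits sk (target_cartan Dk) e ->
    is_sep_family (target_cartan Delta) (mxu_l e) (mxu_r e).
  by rewrite tE => /(target_mxunits_sep hA).
(* The formula for Δ_k(1) is known for e0; uniqueness of the separability idempotent transfers it to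
   every system for the twisted involution. *)
have Dk1 e : is_mxunits sk (target_cartan Dk) e -> Dk 1 = \sum_s
    (fun a => star (kappa (star (k^-1 * a * k))))
      (mxu_l e s * (k^-1 * q)) ⊗ mxu_r e s.
  move=> /sepk se.
  rewrite [LHS](twist_Delta1E hW sep0 D1 k_target k_unit k_kappa2).
  exact (sep_transfer sep0 se (kinv_bilin hWk (mul_linearl _) (@id_linear _ A))).
have kinvkE : (linfun kk)^-1%VF =1 fun a => star (kappa (star (k^-1 * a * k))).
  exact: linfun_invE (wkappa_linear hWk) (wkappaK hWk).
split; [|exact tE| |].
- split.
  + exact ck.
  + exact (wDelta_linear hWk).
  + exact (wDeltaM hWk).
  + move=> a; rewrite (tstar_twist _ cs ck).
    have Tk : tstar star (1 ⊗ k^-1) = 1 ⊗ k^-1.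
      exact (etrans (tstar_tens _ _ cs) (congr2 (@tens _ _ _) (star1 cs) star_kV)).
    exact (twist_Delta_antimorph a (DeltaM hA) (tstarM cs) (Delta_star hA) Tk
      k_unit k_target kV_target).
  + exact (wDelta_coassoc hWk).
  + exact (wkappa_linear hWk).
  + move=> a.
    exact (twist_kappa_star (starM cs) (kappaM hA) (kappa_star hA) k_unit
      star_k star_kV a).
  + exact (wkappaM hWk).
  + exact (wkappa_Delta hWk).
  + exact (wkappa_antipode hWk).
  + exact (weps_linear hWk).
  + move=> a; rewrite /ek /sk /twist_map.
    rewrite (twist_square a (starM cs) (starK cs) cu (star_unit cs cu)
      (starV cs cu) kc).
    exact: (eps_positive hA).
  + exact (weps_counitl hWk).
  + exact (weps_counitr hWk).
  + exact (wepsM hWk).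
- exact (twist_source hW sep0 q_target D1 k_target k_unit).
split.
  split=> [||e he].
  + by rewrite tE; exact (targetM hW kV_target q_target).
  + by rewrite unitrMl ?unitrV.
  + by rewrite (canonical_sumE e _ (wkinv_linear hWk) kinvkE) (Dk1 e he).
move=> p [_ _ pE].
(* A concrete system for the twisted involution, at which the formulas for p and for k^-1 q are
   compared. *)
pose e1 := conj_mxfamily c e0.
have he1 : is_mxunits sk (target_cartan Dk) e1.
  rewrite tE.
  exact (conj_mxunits cs cu kc (@targetM _ _ _ _ _ _ hW) Nc (targetV hW cu Nc) he0).
have sep1 : is_sep_family (target_cartan Dk) (mxu_l e1) (mxu_r e1).
  by rewrite tE; apply: sepk.
have := pE e1 he1.
rewrite (canonical_sumE e1 _ (wkinv_linear hWk) kinvkE).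
exact (kinv_family_inj hWk sep1 (Dk1 e1 he1) (p := p)).
Qed.
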